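(* Up to equivalence of the defining branch data, there are exactly 19 families $\pi:\mathcal{C}\to\mathcal{P}_n$ ($n\ge 1$) of cyclic covers of $\mathbb{P}^1$ which have a pure $(1,n)$-VHS.
   Context: Families of cyclic covers. Let $n\ge 1$ and let $\mu_1,\dots,\mu_{n+3}\in\mathbb{Q}$ with $0<\mu_k<1$ and $\sum_k\mu_k\in\mathbb{Z}$. Let $m$ be the least positive integer with $d_k:=m\mu_k\in\mathbb{Z}$ for all $k$; $d_k$ is called the branch index of the $k$-th branch point. $\mathcal{P}_n\subset(\mathbb{P}^1_{\mathbb{C}})^{n+3}$ is the open set of tuples of pairwise distinct points. These data define the family $\pi:\mathcal{C}\to\mathcal{P}_n$ of irreducible smooth projective curves which is the (normalized) cyclic cover of degree $m$ of $\mathbb{P}^1\times\mathcal{P}_n$ whose fiber over $q=(a_1,\dots,a_{n+3})$ is the smooth projective model $\mathcal{C}_q$ of $y^m=\prod_k(x-a_k)^{d_k}$ (omitting the factor with $a_k=\infty$, if any). Its Galois group $\mathbb{Z}/m$ is generated by $\psi:(x,y)\mapsto(x,e^{2\pi i/m}y)$. Eigenspaces. For $1\le j\le m-1$, $\mathcal{L}_j\subset R^1\pi_*\mathbb{C}$ is the local subsystem on which $\psi$ acts (by push-forward) by $e^{2\pi i j/m}$. It is of type $(p,q)$ if on the fibers $p=h^{1,0}_j$, $q=h^{0,1}_j$ are the dimensions of the $(1,0)$ and $(0,1)$ parts of the eigenspace. Explicitly, with $\{t\}$ the fractional part, $p=-1+\sum_{k:\,j\mu_k\notin\mathbb{Z}}\{j\mu_k\}$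 and $q=-1+\sum_{k:\,j\mu_k\notin\mathbb{Z}}(1-\{j\mu_k\})$. Pure $(1,n)$-VHS. The family $\mathcal{C}\to\mathcal{P}_n$ has a pure $(1,n)$-VHS if there is a $j$ such that $\mathcal{L}_j$ is of type $(1,n)$ and $\mathcal{L}_{m-j}$ is of type $(n,1)$ (here $j=m-j$ is allowed), and all other eigenspaces are of type $(a,0)$ or $(0,b)$ for some integers $a,b\ge 0$. Counting convention. Two families given by $(m;d_1,\dots,d_{n+3})$ and $(m';d'_1,\dots,d'_{n'+3})$ are counted as the same if $m=m'$, $n=n'$, and after a permutation of the indices $d'_k\equiv u\,d_k \bmod m$ for all $k$, for some unit $u\in(\mathbb{Z}/m)^*$. *)

(* Defs.v *)
(* The complex field is R[i] for R : realType.

   Cohomology of a fiber X is taken with its Hodge decomposition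
   H^1(X, C) = H^{1,0} (+) H^{0,1}, where H^{1,0} = H^0(X, Omega^1) is the space
   of holomorphic 1-forms and H^{0,1} its complex conjugate. *)
From HB Require Import structures.
From mathcomp Require Import all_boot all_order all_algebra fraction.
From mathcomp Require Import complex.
From mathcomp Require Import all_classical reals topology normedtype trigo.

Set Implicit Arguments.
Unset Strict Implicit.
Unset Printing Implicit Defensive.

Import Order.TTheory GRing.Theory Num.Theory.

Local Open Scope ring_scope.
Local Open Scope complex_scope.

Record branch_data := BranchData {
  bd_n : nat;
  bd_mu : 'I_bd_n.+3 -> rat;
  bd_n_gt0 : (0 < bd_n)%N;
  bd_mu_bounds : forall k, 0 < bd_mu k < 1;
  bd_mu_sum : \sum_k bd_mu k \is a Num.int }.

Arguments bd_mu : clear implicits.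

Definition clears_denominators (D : branch_data) (m : nat) : bool :=
  (0 < m)%N && [forall k, m%:R * bd_mu D k \is a Num.int].

Lemma clears_denominators_ex (D : branch_data) :
  exists m, clears_denominators D m.
Proof.
exists (\prod_k `|denq (bd_mu D k)|%N)%N; apply/andP; split.
  by apply: prodn_gt0 => k; rewrite absz_gt0 denq_neq0.
apply/forallP => k; rewrite (bigD1 k) //= mulnC natrM -mulrA.
apply: rpredM; first exact: rpred_nat.
rewrite -{2}[bd_mu D k]divq_num_den mulrCA pmulrn absz_denq divff ?mulr1.
  exact: rpred_int.
by rewrite intr_eq0 denq_neq0.
Qed.

Definition bd_m (D : branch_data) : nat := ex_minn (clears_denominators_ex D).

(* m * mu_k is a positive integer, so [Num.truncn] only changes its type. *)
Definition bd_d (D : branch_data) (k : 'I_(bd_n D).+3) : nat :=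
  Num.truncn ((bd_m D)%:R * bd_mu D k).

Arguments bd_d : clear implicits.

Definition same_family (D D' : branch_data) : Prop :=
  [/\ bd_m D = bd_m D', bd_n D = bd_n D' &
      exists (s : 'I_(bd_n D).+3 -> 'I_(bd_n D').+3) (u : nat),
        [/\ bijective s, coprime u (bd_m D) &
            forall k, bd_d D' (s k) = (u * bd_d D k)%N %[mod bd_m D]]].

Section Fiber.
Variables (R : realType) (D : branch_data).
Local Notation C := R[i].
Local Notation n := (bd_n D).
Local Notation m := (bd_m D).

(* P^1(C), with None the point at infinity *)
Definition P1 := option C.

(* A configuration; it lies in P_n iff it is injective. *)
Variable a : 'I_n.+3 -> P1.

Definition cover_poly : {poly C} :=
  \prod_k (if a k is Some b then ('X - b%:P) ^+ bd_d D k else 1).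

(* Since m is coprime to gcd_k d_k, the function field of the curve
   y^m = cover_poly(x) is C(x)[y]/(y^m - cover_poly). So a meromorphic 1-form on
   its smooth projective model is uniquely g(x,y) dx with g in C(x)[y] of degree
   < m in y, and it is encoded by g. *)
Definition form := {poly {fraction {poly C}}}.

(* The representative [repr h] need not be in lowest terms, so the value may be
   junk at finitely many points; only punctured neighbourhoods are used below. *)
Definition eval_frac (h : {fraction {poly C}}) (x : C) : C :=
  (frac (repr h)).1.[x] / (frac (repr h)).2.[x].

Definition eval_form (g : form) (x y : C) : C :=
  \sum_(i < size g) eval_frac g`_i x * y ^+ i.

(* Ramification index of the cover over p. At infinity it is determined by
   deg cover_poly, which is congruent mod m to minus the branch index there
   because m divides the sum of all d_k. *)
Definition ramification (p : P1) : nat :=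
  (m %/ gcdn m (\sum_(k | a k == p) bd_d D k))%N.

(* Let e be the ramification index over p. At each point of the smooth projective
   model over p there is a local coordinate t with x = b + t^e if p = b is finite
   and x = t^-e if p is infinity. [chart_x] and [chart_dx] are x and dx/dt. *)
Definition chart_x (p : P1) (t : C) : C :=
  if p is Some b then b + t ^+ ramification p else t ^- ramification p.

Definition chart_dx (p : P1) (t : C) : C :=
  let e := ramification p in
  if p is Some _ then e%:R * t ^+ e.-1 else - (e%:R * t ^- e.+1).

(* In these coordinates the form is (g(x,y) dx/dt) dt, where y runs over the
   branches of the m-th root of cover_poly(x). The coefficient is meromorphic, so
   it is holomorphic at t = 0 iff it is bounded near t = 0. *)
Definition holomorphic_over (g : form) (p : P1) : Prop :=
  exists r M : C, 0 < r /\
    forall t y : C, 0 < `|t| < r -> y ^+ m = cover_poly.[chart_x p t] ->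
      `|eval_form g (chart_x p t) y * chart_dx p t| <= M.

Definition holomorphic_form (g : form) : Prop :=
  (size g <= m)%N /\ forall p, holomorphic_over g p.

Definition zeta : C :=
  cos (2%:R * pi / m%:R) +i* sin (2%:R * pi / m%:R).

Definition const (c : C) : {fraction {poly C}} := FracField.tofrac c%:P.

(* psi(x,y) = (x, zeta y); push-forward is pull-back along the inverse of psi. *)
Definition psi_push (g : form) : form :=
  g \Po (const zeta^-1 *: 'X).

Definition holomorphic_eigenform (lambda : C) (g : form) : Prop :=
  holomorphic_form g /\ psi_push g = const lambda *: g.

Definition has_dim (V : form -> Prop) (d : nat) : Prop :=
  exists w : 'I_d -> form,
    (forall c : 'I_d -> C,
       \sum_i const (c i) *: w i = 0 -> forall i, c i = 0) /\
    (forall g, V g <-> exists c : 'I_d -> C, g = \sum_i const (c i) *: w i).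

Definition h10 (j p : nat) : Prop :=
  has_dim (holomorphic_eigenform (zeta ^+ j)) p.

(* psi_push commutes with complex conjugation of forms, so the conjugate of w is
   a zeta^j-eigenvector iff w is an eigenvector for the conjugate of zeta^j. *)
Definition h01 (j q : nat) : Prop :=
  has_dim (holomorphic_eigenform (zeta ^+ j)^*) q.

End Fiber.

Definition eigenspace_type (R : realType) (D : branch_data) (j p q : nat) :=
  forall a : 'I_(bd_n D).+3 -> P1 R, injective a -> h10 a j p /\ h01 a j q.

Definition pure_VHS (R : realType) (D : branch_data) : Prop :=
  let n := bd_n D in let m := bd_m D in
  exists j : nat,
    [/\ (0 < j < m)%N, eigenspace_type R D j 1 n,
        eigenspace_type R D (m - j) n 1 &
        forall i : nat, (0 < i < m)%N -> i <> j -> i <> (m - j)%N ->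
          (exists p, eigenspace_type R D i p 0) \/
          (exists q, eigenspace_type R D i 0 q)].

(* Main.v *)
From Stdlib Require Import ZArith List Lia.
Require Import Defs.
From HB Require Import structures.
From mathcomp Require Import all_boot all_order all_algebra fraction.
From mathcomp Require Import complex generic_quotient.
From mathcomp Require Import all_classical reals topology normedtype trigo.
From mathcomp Require cyclic.
From mathcomp Require Import ring lra zify.

Set Implicit Arguments.
Unset Strict Implicit.
Unset Printing Implicit Defensive.

Import Order.TTheory GRing.Theory Num.Theory.

(** Hodge numbers. For [0 < i < m] an eigenform is [h(x) y^i dx] with [h]
    rational. The [m]-th power of its coefficient in a local coordinate does not
    involve the branch of [y], because [y^m] is [cover_poly]; so holomorphy over a
    point says that one exponent is nonnegative. This is a lower bound on the
    order of [h] there, namely [- ceil(i d_k / m)] at a finite branch point and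
    [0] at other finite points; over infinity it is a bound on the degree. Hence
    [h = P / prod_k (x - a_k)^(ceil(i d_k / m))] with [P] of bounded degree
    ([holomorphic_formP]). Since [psi_push] turns [y^i] into [zeta^-i y^i], the
    eigenvalue [zeta^j] belongs to [i = m - j], and its eigenspace has dimension
    [sum_k {j d_k / m} - 1] for every configuration ([h10P], [h01P]).

    Arithmetic form of purity ([pure_VHSP], [pure_at]). There is an index [j] such
    that no [j d_k] is divisible by [m], the residues of the [j d_k] add up to
    [2m], and no index other than [j] and [m - j] is mixed, that is, has both
    Hodge numbers positive.

    Finiteness. It rests on three reductions.
    - Replacing two entries [x, y] of [d] by [x + y] does not increase any Hodge
      number, since [{s + t} <= {s} + {t}]. When the residues of [jx] and [jy]
      add up to less than [m], purity at [j] survives, so one descends to four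
      points with the same [m] and [j] ([pure_at_four]).
    - Multiplying [d] by a unit makes [j] the divisor [g = gcdn j m] of [m]. Put
      [M = m / g]; then [d] modulo [M] is pure at [1]. For four points it gives a
      point of the open unit cube with coordinate sum [2], and each such real
      point has a multiple by some [i] in [2..11] whose fractional parts are
      nonzero and again add up to [2]. So [i] is mixed, and this contradicts
      purity as soon as [M > 12] ([four_point_order_bound]).
    - For given residues modulo [M] the same argument is applied to the point
      [d / m], whose [g]-th multiple is known modulo integers, with the
      multipliers [s] and [g + s], [g - s] for [s <= 3]. It gives [g <= 3]
      ([four_point_index_bound]).
    Both real statements are proved by cutting the cube into boxes on which the
    integral parts are constant ([refutedP]). The remaining data, with any number
    of points, are the lifts of partitions of [2M] with [M <= 12] and [g <= 3];
    they are enumerated and matched with 19 pairwise inequivalent representatives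
    ([pure_data_tabulated], [table_inequivalent]). *)
Delimit Scope Z_scope with BZ.

(** * Balanced multiples of real points *)

Section CellSearch.
Local Open Scope Z_scope.

Definition zsum (l : seq Z) : Z := foldr Z.add 0 l.

(** A constraint on a pair [(h, x)] in units of [m / Q]: [h] is known exactly and
    equals [shift], while [x] lies strictly between [lo] and [hi], or equals [lo]
    when [lo = hi]. All end points share the denominator [Q], so that comparisons
    are between integers. *)
Record cell := Cell { shift : Z; lo : Z; hi : Z }.

Definition cut (k : Z) (c : cell) : seq cell :=
  if (lo c <? k) && (k <? hi c)
  then [:: Cell (shift c) (lo c) k; Cell (shift c) k k; Cell (shift c) k (hi c)]
  else [:: c].

(** The values of [x], in units of [m / Q], at which [a * h + s * x] is a multiple
    of [m], for [Q] divisible enough. Any cuts yield a cover of the cell; these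
    ones make the integral part constant on each piece. *)
Definition cut_points (Q a s : Z) (c : cell) : seq Z :=
  let y := a * shift c in
  let n := Z.to_nat (2 * Z.abs s + 2) in
  [seq ((y / Q - Z.abs s + Z.of_nat t) * Q - y) / s | t <- iota 0 n].

Definition cut_all (ks : seq Z) (c : cell) : seq cell :=
  foldr (fun k => flat_map (cut k)) [:: c] ks.

Fixpoint subboxes (Q a s : Z) (b : seq cell) : seq (seq cell) :=
  if b is c :: b' then
    let bs := subboxes Q a s b' in
    flat_map (fun c' => map (cons c') bs) (cut_all (cut_points Q a s c) c)
  else [:: [::]].

(** The coordinate sum is meant to be [T * m], and a box with an open side misses
    both extreme values of the sum. *)
Definition infeasible (Q T : Z) (b : seq cell) : bool :=
  let l := zsum (map lo b) in let h := zsum (map hi b) in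
  if l =? h then ~~ (l =? Q * T) else (Q * T <=? l) || (h <=? Q * T).

Definition cell_floor (Q a s : Z) (c : cell) : option Z :=
  let y1 := a * shift c + s * lo c in
  let y2 := a * shift c + s * hi c in
  let f := Z.min y1 y2 / Q in
  if lo c =? hi c then (if y1 =? f * Q then None else Some f)
  else if (~~ (y1 =? y2)) && (Z.max y1 y2 <=? (f + 1) * Q) then Some f else None.

Fixpoint box_floor (Q a s : Z) (b : seq cell) : option Z :=
  if b is c :: b' then
    if (cell_floor Q a s c, box_floor Q a s b') is (Some f, Some F)
    then Some (f + F) else None
  else Some 0.

(** In units of [m]: if the integral parts of the [a * h + s * x] add up to [F],
    then the fractional parts add up to [a * sum h + s * T - F], and the equation
    makes this [2]. *)
Definition forces_balance (Q T a s : Z) (b : seq cell) : bool :=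
  if box_floor Q a s b is Some F
  then Q * (F + 2) =? a * zsum (map shift b) + s * Q * T else false.

(** The boxes left undecided by one test are cut further for the next one; the
    search succeeds when every box is empty or decided by some test. *)
Fixpoint refuted (Q T : Z) (tests : seq (Z * Z)) (b : seq cell) : bool :=
  if tests is (a, s) :: tests' then
    all (fun b' => if infeasible Q T b' then true
                   else if forces_balance Q T a s b' then true
                   else refuted Q T tests' b')
        (subboxes Q a s b)
  else false.

Definition multiples (a s : Z) (ps : seq (Z * Z)) : seq Z :=
  [seq a * p.1 + s * p.2 | p <- ps].

(** For four numbers with nonzero residues, a residue sum of [2m] is the value for
    which both Hodge numbers of the corresponding index equal [1]. *)
Definition balanced (m : Z) (zs : seq Z) : bool :=
  all (fun z => ~~ (z mod m =? 0)) zs && (zsum [seq z mod m | z <- zs] =? 2 * m).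

Variables (Q m : Z).
Hypotheses (Q_gt0 : 0 < Q) (m_gt0 : 0 < m).

Definition in_cell (c : cell) (p : Z * Z) : Prop :=
  Q * p.1 = shift c * m /\
  (if lo c =? hi c then Q * p.2 = lo c * m
   else lo c * m < Q * p.2 < hi c * m).

Fixpoint in_box (b : seq cell) (ps : seq (Z * Z)) : Prop :=
  match b, ps with
  | [::], [::] => True
  | c :: b', p :: ps' => in_cell c p /\ in_box b' ps'
  | _, _ => False
  end.

Lemma cut_cover k c p : in_cell c p ->
  exists c', List.In c' (cut k c) /\ in_cell c' p.
Proof.
case=> hs hc; rewrite /cut; case: ifP => [/andP[/Z.ltb_lt h1 /Z.ltb_lt h2]|_].
  move: hc; rewrite (proj2 (Z.eqb_neq _ _)); last lia.
  move=> hc; case: (Z.lt_trichotomy (Q * p.2) (k * m)) => [h|[h|h]].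
  - exists (Cell (shift c) (lo c) k); split; first by left.
    by split=> //=; rewrite (proj2 (Z.eqb_neq _ _)); lia.
  - exists (Cell (shift c) k k); split; first by right; left.
    by split=> //=; rewrite Z.eqb_refl.
  - exists (Cell (shift c) k (hi c)); split; first by right; right; left.
    by split=> //=; rewrite (proj2 (Z.eqb_neq _ _)); lia.
by exists c; split; [left | split].
Qed.

Lemma cut_all_cover ks c p : in_cell c p ->
  exists c', List.In c' (cut_all ks c) /\ in_cell c' p.
Proof.
move=> cp; elim: ks => [|k ks [c1 [c1_in c1p]]] /=; first by exists c; split; [left|].
have [c2 [c2_in c2p]] := cut_cover k c1p.
by exists c2; split=> //; apply/in_flat_map; exists c1.
Qed.

Lemma subboxes_cover a s b ps : in_box b ps ->
  exists b', List.In b' (subboxes Q a s b) /\ in_box b' ps.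
Proof.
elim: b ps => [|c b IHb] [|p ps] //=; first by exists [::]; split; [left|].
case=> cp /IHb[b' [b'_in b'ps]].
have [c' [c'_in c'p]] := cut_all_cover (cut_points Q a s c) cp.
exists (c' :: b'); split=> //; apply/in_flat_map; exists c'; split=> //.
exact: in_map.
Qed.

Lemma in_box_bounds b ps : in_box b ps ->
  (zsum (map lo b) = zsum (map hi b) ->
     Q * zsum (map snd ps) = zsum (map lo b) * m) /\
  zsum (map lo b) <= zsum (map hi b) /\
  (zsum (map lo b) < zsum (map hi b) ->
   zsum (map lo b) * m < Q * zsum (map snd ps) < zsum (map hi b) * m).
Proof.
elim: b ps => [|c b IHb] [|p ps] //=; first by lia.
case=> -[_ hc] /IHb; move: hc.
set L := zsum (map lo b); set H := zsum (map hi b); set X := zsum (map snd ps).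
rewrite Z.mul_add_distr_l !Z.mul_add_distr_r.
case: Z.eqb_spec => [<- hc|ne hc] [h1 [h2 h3]].
  split; [move=> e; have := h1 ltac:(lia) | split; [|move=> e; have := h3 ltac:(lia)]];
  by lia.
have lt_c : lo c < hi c by apply: (Zmult_lt_reg_r _ _ m); lia.
split; [lia | split; [lia | move=> _]].
clear IHb; move: L H X h1 h2 h3 => L H X h1 h2 h3.
case: (Z.lt_trichotomy L H) => [lt|[e|lt]]; last by lia.
  by have := h3 lt; lia.
by have := h1 e; rewrite -e; lia.
Qed.

Lemma infeasibleP T b ps : in_box b ps -> zsum (map snd ps) = T * m ->
  infeasible Q T b = false.
Proof.
move=> /in_box_bounds[h1 [h2 h3]] hT; rewrite hT in h1 h3; rewrite /infeasible.
case: Z.eqb_spec => [e|ne].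
  by apply/negbTE; rewrite negbK; apply/Z.eqb_eq; have := h1 e; nia.
have {}h3 := h3 ltac:(lia).
by apply/negbTE; rewrite negb_or -!Z.ltb_antisym; apply/andP; split;
  apply/Z.ltb_lt; nia.
Qed.

(** The affine function [a * h + s * x] is monotone in [x], so its integral part
    over a cell is controlled by its values at the two ends. *)
Lemma cell_floorP a s c p f : in_cell c p -> cell_floor Q a s c = Some f ->
  f * m < a * p.1 + s * p.2 < (f + 1) * m.
Proof.
case=> hs; rewrite /cell_floor.
set y1 := a * shift c + s * lo c; set y2 := a * shift c + s * hi c.
set z := a * p.1 + s * p.2.
have hf : Z.min y1 y2 / Q * Q <= Z.min y1 y2 < (Z.min y1 y2 / Q + 1) * Q.
  by have := Z.mul_div_le (Z.min y1 y2) Q Q_gt0;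
     have := Z.mul_succ_div_gt (Z.min y1 y2) Q Q_gt0; lia.
have Qz : Q * z = a * shift c * m + s * (Q * p.2).
  by rewrite -(Z.mul_assoc a) -hs /z; ring.
case: (Z.eqb_spec (lo c)) => [e|ne] hc.
  have y12 : y2 = y1 by rewrite /y1 /y2 e.
  rewrite y12 Z.min_id in hf *.
  case: Z.eqb_spec => // ne [<-].
  have Qzy : Q * z = y1 * m by rewrite Qz hc /y1; ring.
  by move: (y1 / Q) hf ne => g hf ne; nia.
case: Z.eqb_spec => //= ne12; case: Z.leb_spec => // le [ef]; rewrite ef in hf le.
have Qzy : Z.min y1 y2 * m < Q * z < Z.max y1 y2 * m.
  have e1 : y1 * m = a * shift c * m + s * (lo c * m) by rewrite /y1; ring.
  have e2 : y2 * m = a * shift c * m + s * (hi c * m) by rewrite /y2; ring.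
  have s_ne0 : s <> 0 by move=> s0; apply: ne12; rewrite /y1 /y2 s0.
  have : y1 * m < Q * z < y2 * m \/ y2 * m < Q * z < y1 * m.
    by rewrite e1 e2 Qz; case: (Z.lt_trichotomy s 0) => [h|[//|h]]; [right|left]; nia.
  by nia.
by nia.
Qed.

Lemma box_floorP a s b ps F : in_box b ps -> box_floor Q a s b = Some F ->
  all (fun z => ~~ (z mod m =? 0)) (multiples a s ps) /\
  zsum [seq z mod m | z <- multiples a s ps] = zsum (multiples a s ps) - F * m.
Proof.
elim: b ps F => [|c b IHb] [|p ps] F //=; first by move=> _ [<-].
case=> cp bps; case cf: cell_floor => [f|//]; case bf: box_floor => [F'|//] [<-].
have [h1 h2] := IHb _ _ bps bf; have h := cell_floorP cp cf.
set z := a * p.1 + s * p.2 in h *.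
have zm : z mod m = z - f * m.
  by symmetry; apply: (Z.mod_unique_pos _ _ f); lia.
rewrite h1 h2 zm andbT; split; last by ring.
by apply/negP => /Z.eqb_eq; lia.
Qed.

Lemma in_box_sum a s b ps : in_box b ps ->
  Q * zsum (multiples a s ps) =
    a * (zsum (map shift b) * m) + s * (Q * zsum (map snd ps)).
Proof.
elim: b ps => [|c b IHb] [|p ps] //=; first by lia.
case=> -[hs _] /IHb; rewrite -/(multiples a s ps) => h.
rewrite Z.mul_add_distr_l {}h !Z.mul_add_distr_l Z.mul_add_distr_r -hs; ring.
Qed.

Lemma forces_balanceP T a s b ps : in_box b ps -> zsum (map snd ps) = T * m ->
  forces_balance Q T a s b -> balanced m (multiples a s ps).
Proof.
move=> bps hT; rewrite /forces_balance; case bf: box_floor => [F|//] /Z.eqb_eq hF.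
have [h1 h2] := box_floorP bps bf; rewrite /balanced h1 h2.
have := in_box_sum a s bps; rewrite hT => hs; apply/Z.eqb_eq.
have : Q * zsum (multiples a s ps) = Q * ((F + 2) * m) by rewrite hs; nia.
by move/(Z.mul_reg_l _ _ Q ltac:(lia)) => ->; ring.
Qed.

(** Soundness of the search: the point stays in one of the subboxes at each stage,
    and only a successful test can close a box that contains a point. *)
Lemma refutedP T tests b ps : refuted Q T tests b -> in_box b ps ->
  zsum (map snd ps) = T * m ->
  exists t, List.In t tests /\ balanced m (multiples t.1 t.2 ps).
Proof.
elim: tests b => [|[a s] tests IH] b //= allb bps hT.
have [b' [b'_in b'ps]] := subboxes_cover a s bps.
have : forall l, List.In b' l -> all (fun b' => if infeasible Q T b' then true
                   else if forces_balance Q T a s b' then true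
                   else refuted Q T tests b') l ->
       forces_balance Q T a s b' \/ refuted Q T tests b'.
  elim=> //= b1 l IHl [->|b1l] /andP[hb1 hl]; last exact: IHl.
  by move: hb1; rewrite (infeasibleP b'ps hT); case: ifP => _; [left|right].
case/(_ _ b'_in allb) => [/(forces_balanceP b'ps hT) h|].
  by exists (a, s); split; [left|].
by case/IH=> // t [t_in ht]; exists t; split; [right|].
Qed.

End CellSearch.

(** * Residue sums, merging and normalization *)
Definition wsum (m : nat) (d : seq nat) (i : nat) : nat :=
  sumn [seq (i * x) %% m | x <- d].

(** [wsum m d i] is [m] times the sum of the [{i d_k / m}], which exceeds the
    Hodge number by one; so this says that both Hodge numbers are positive. *)
Definition mixed (m : nat) (d : seq nat) (i : nat) : bool :=
  (2 * m <= wsum m d i) && (2 * m <= wsum m d (m - i)).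

(** The number of entries minus three replaces the relative dimension here: if no
    [j x] is divisible by [m], the residue sums of [j] and [m - j] add up to
    [m * size d]. The condition that [m] is the least common denominator is left
    out, as it is not stable under the reductions below. *)
Definition pure_at (m j : nat) (d : seq nat) : Prop :=
  [/\ 0 < j < m, all (fun x => (x < m) && ~~ (m %| j * x)) d, m %| sumn d,
      wsum m d j = 2 * m &
      forall i, 0 < i < m -> i != j -> i != m - j -> ~~ mixed m d i].

Lemma perm_wsum m d d' i : perm_eq d d' -> wsum m d i = wsum m d' i.
Proof. by move=> dd'; apply/perm_sumn/perm_map. Qed.

Lemma perm_mixed m d d' i : perm_eq d d' -> mixed m d i = mixed m d' i.
Proof. by move=> dd'; rewrite /mixed !(perm_wsum _ _ dd'). Qed.

Lemma perm_pure_at m j d d' : perm_eq d d' -> pure_at m j d -> pure_at m j d'.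
Proof.
move=> dd' [j_bnd d_bnd d_sum d_j d_i]; split=> //.
- by rewrite -(perm_all _ dd').
- by rewrite -(perm_sumn dd').
- by rewrite -(perm_wsum _ _ dd').
by move=> i i_bnd ij imj; rewrite -(perm_mixed _ _ dd') d_i.
Qed.

Lemma wsum_modr m d i : wsum m [seq x %% m | x <- d] i = wsum m d i.
Proof.
by rewrite /wsum -map_comp; congr sumn; apply: eq_map => x /=; rewrite modnMmr.
Qed.

Lemma wsum_modl m d i : wsum m d (i %% m) = wsum m d i.
Proof. by congr sumn; apply: eq_map => x; rewrite modnMml. Qed.

Lemma wsum_scale m d u i : wsum m [seq (u * x) %% m | x <- d] i = wsum m d (i * u).
Proof.
by rewrite /wsum -map_comp; congr sumn; apply: eq_map => x /=; rewrite modnMmr mulnA.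
Qed.

Lemma wsumMl g M d i : 0 < g -> wsum (g * M) d (g * i) = g * wsum M d i.
Proof.
move=> g_gt0; rewrite /wsum; elim: d => [|x d IHd] /=; first by rewrite muln0.
by rewrite IHd mulnDr muln_modr mulnA.
Qed.

Lemma addn_modN m a b : 0 < m -> m %| a + b ->
  a %% m + b %% m = m * ~~ (m %| a).
Proof.
move=> m_gt0 ab; have h : m %| a %% m + b %% m by rewrite /dvdn modnDm.
have [ha|ha] := boolP (m %| a).
  by move: (ab); rewrite dvdn_addr // /dvdn (eqP ha) => /eqP ->; rewrite muln0.
rewrite muln1; case/dvdnP: h => k hk.
have a_gt0 : 0 < a %% m by rewrite lt0n.
have := ltn_pmod a m_gt0; have := ltn_pmod b m_gt0 => hb ha'.
have k1 : k = 1; last by rewrite hk k1 mul1n.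
by nia.
Qed.

Lemma wsum_opp m d i : 0 < m -> i <= m ->
  wsum m d i + wsum m d (m - i) = m * count (fun x => ~~ (m %| i * x)) d.
Proof.
move=> m_gt0 i_le; rewrite /wsum; elim: d => [|x d IHd] /=; first by rewrite muln0.
rewrite mulnDr -IHd -(@addn_modN m (i * x) ((m - i) * x)) //; first by lia.
by rewrite -mulnDl subnKC // dvdn_mulr.
Qed.

Lemma dvdn_wsum m d i : m %| sumn d -> m %| wsum m d i.
Proof.
move=> d_sum; have : wsum m d i = i * sumn d %[mod m].
  rewrite /wsum; elim: d {d_sum} => [|x d IHd] /=; first by rewrite muln0.
  by rewrite mulnDr modnDml -modnDmr IHd modnDmr.
by rewrite /dvdn => ->; rewrite -/(dvdn _ _) dvdn_mull.
Qed.

Lemma modnD_le m x y : (x + y) %% m <= x %% m + y %% m.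
Proof. by rewrite -modnDm leq_mod. Qed.

(** Letting two branch points collide does not increase any Hodge number. *)
Lemma wsum_merge m x y d i :
  wsum m ((x + y) %% m :: d) i <= wsum m [:: x, y & d] i.
Proof. by rewrite /wsum /= modnMmr mulnDr addnA leq_add2r modnD_le. Qed.

Lemma pure_at_merge m j x y d : (j * x) %% m + (j * y) %% m < m ->
  pure_at m j [:: x, y & d] -> pure_at m j ((x + y) %% m :: d).
Proof.
move=> xy [j_bnd /= /and3P[x_bnd y_bnd d_bnd] d_sum d_j d_i].
have m_gt0 : 0 < m by lia.
have jxy : (j * ((x + y) %% m)) %% m = (j * x) %% m + (j * y) %% m.
  by rewrite modnMmr mulnDr -modnDm modn_small.
split=> //=.
- rewrite d_bnd ltn_pmod //= andbT /dvdn jxy addn_eq0 negb_and.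
  by case/andP: x_bnd => _ ->.
- by rewrite /dvdn modnDml -addnA.
- by rewrite -d_j /wsum /= jxy addnA.
move=> i i_bnd ij imj; apply: contra (d_i i i_bnd ij imj).
by case/andP=> h1 h2; apply/andP; split;
  [apply: leq_trans h1 _ | apply: leq_trans h2 _]; apply: wsum_merge.
Qed.

(** Five or more positive residues with sum [2m] contain two disjoint pairs, and
    these cannot both have sum at least [m]; a pair with smaller sum is merged. *)
Lemma pure_at_four m j d : 4 <= size d -> pure_at m j d ->
  exists2 d', size d' = 4 & pure_at m j d'.
Proof.
elim/ltn_ind: {d}(size d) {-2}d (erefl (size d)) => n IHn d dn d_ge4 d_pure.
have [d4|d_ne4] := eqVneq (size d) 4; first by exists d.
case: d => [|x [|y [|z [|t [|w d]]]]] // in dn d_ge4 d_pure d_ne4 *.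
have [xy|xy] := ltnP ((j * x) %% m + (j * y) %% m) m.
  by apply: (IHn _ _ _ (erefl _) _ (pure_at_merge xy d_pure)); rewrite -?dn.
(* The first pair is too large; the fifth residue is positive, so the second pair
   is small enough. *)
have d_pure' : pure_at m j [:: z, t, x, y, w & d].
  apply: perm_pure_at d_pure.
  by apply/permPl; exact: (perm_catCA [:: x; y] [:: z; t] (w :: d)).
apply: (IHn _ _ _ (erefl _) _ (pure_at_merge _ d_pure')); rewrite -?dn //.
case: d_pure => j_bnd /= /and5P[_ _ _ _ /andP[/andP[_ w_ne0] _]] _; rewrite /wsum /= => d_j _.
move: w_ne0 xy d_j; rewrite /dvdn.
move: (_ %% m) (_ %% m) (_ %% m) (_ %% m) (_ %% m) (sumn _) => a b c e f r.
by clear; lia.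
Qed.

(** The quotient [j / gcdn j m] is a unit modulo [M = m / gcdn j m]. Adding to it
    the multiple [M t], where [t] is the part of [m] prime to [j / gcdn j m] and
    to [M], avoids every prime divisor of [m]. *)
Lemma unit_lift m j : 0 < j -> 0 < m ->
  exists2 v, coprime v m & gcdn j m * v = j %[mod m].
Proof.
move=> j_gt0 m_gt0; set g := gcdn j m.
have g_gt0 : 0 < g by rewrite gcdn_gt0 j_gt0.
have [/dvdnP[j' ej] /dvdnP[M em]] : g %| j /\ g %| m by rewrite dvdn_gcdl dvdn_gcdr.
have jM : coprime j' M.
  by rewrite /coprime -(eqn_pmul2r g_gt0) mul1n muln_gcdl -ej -em.
pose t := m`_(\pi(j' * M)^').
have M_gt0 : 0 < M by move: m_gt0; rewrite em muln_gt0 => /andP[].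
have j'_gt0 : 0 < j' by move: j_gt0; rewrite ej muln_gt0 => /andP[].
exists (j' + M * t); last first.
  by rewrite mulnDr mulnA [g * M]mulnC -em -modnDmr modnMr addn0 mulnC -ej.
rewrite coprime_sym coprime_has_primes ?addn_gt0 ?j'_gt0 //.
apply/hasPn => p; rewrite !mem_primes m_gt0 addn_gt0 j'_gt0 /= => /andP[p_pr p_v].
rewrite p_pr /=; apply/negP => p_m.
have [pj|pj] := boolP (p %| j').
  have pM : ~~ (p %| M).
    apply/negP => pM; have : p %| gcdn j' M by rewrite dvdn_gcd pj.
    by rewrite (eqP jM) dvdn1 => /eqP p1; rewrite p1 in p_pr.
  move: p_v; rewrite dvdn_addr // Euclid_dvdM // (negPf pM) /= => pt.
  have : p \in \pi(j' * M)^'.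
    by apply: (pnatP _ _ (part_pnat _ m)) => //; rewrite part_gt0.
  by rewrite !inE mem_primes p_pr muln_gt0 j'_gt0 M_gt0 Euclid_dvdM // pj.
have [pM|pM] := boolP (p %| M).
  by move: p_v; rewrite dvdn_addl ?dvdn_mulr // (negPf pj).
have pt : p %| t.
  have pi_p : p \in \pi(j' * M)^'.
    by rewrite !inE mem_primes Euclid_dvdM // (negPf pj) (negPf pM) !andbF.
  rewrite /t -(@partnC \pi(j' * M)^' m) // Euclid_dvdM // in p_m.
  case/orP: p_m => // p_t'.
  have := part_pnat (\pi(j' * M)^')^' m => /pnatP -/(_ (part_gt0 _ _)).
  by move/(_ p p_pr p_t'); rewrite inE /= pi_p.
by move: p_v; rewrite dvdn_addl ?dvdn_mull // (negPf pj).
Qed.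

Lemma coprime_modI m v a b : coprime v m -> v * a = v * b %[mod m] -> a = b %[mod m].
Proof.
move=> vm; wlog ab : a b / a <= b => [hw|] e.
  by case: (leqP a b) => [/hw|/ltnW /hw h]; [apply | rewrite h].
move/eqP: e; rewrite eq_sym eqn_mod_dvd ?leq_mul2l ?ab ?orbT // -mulnBr.
by rewrite Gauss_dvdr 1?coprime_sym // -eqn_mod_dvd // => /eqP ->.
Qed.

Lemma coprime_dvd_mul m v x : coprime v m -> (m %| v * x) = (m %| x).
Proof. by move=> vm; rewrite Gauss_dvdr // coprime_sym. Qed.

Lemma mixed_scale m v d i : i < m ->
  mixed m [seq (v * x) %% m | x <- d] i = mixed m d ((i * v) %% m).
Proof.
case: (posnP m) => [->|m_gt0 i_lt] //; rewrite /mixed !wsum_scale wsum_modl.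
congr (_ && (_ <= _)); rewrite -[LHS]wsum_modl -[RHS]wsum_modl; congr wsum.
have h : (i * v) %% m + (m - (i * v) %% m) = m by rewrite subnKC // ltnW // ltn_pmod.
apply/eqP; rewrite -(eqn_modDl ((i * v) %% m)) h modnDml -mulnDl subnKC ?(ltnW i_lt) //.
by rewrite modnn modnMr.
Qed.

(** Multiplying the data by a unit permutes the indices, so the distinguished index
    can be moved to any index with the same gcd with [m]. *)
Lemma pure_at_normalize m j d : pure_at m j d ->
  exists2 v, coprime v m & pure_at m (gcdn j m) [seq (v * x) %% m | x <- d].
Proof.
move=> [j_bnd d_bnd d_sum d_j d_i].
have [m_gt0 j_gt0] : 0 < m /\ 0 < j by lia.
have [v vm gv] := unit_lift j_gt0 m_gt0; exists v => //; set g := gcdn j m in gv *.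
have g_gt0 : 0 < g by rewrite gcdn_gt0 j_gt0.
have g_le : g <= j by rewrite dvdn_leq ?dvdn_gcdl.
split.
- by lia.
- rewrite all_map; apply: sub_all d_bnd => x /= /andP[_ jx].
  by rewrite ltn_pmod //= /dvdn modnMmr mulnA -modnMml gv modnMml.
- rewrite /dvdn; have -> : sumn [seq (v * x) %% m | x <- d] = wsum m d v by [].
  exact: dvdn_wsum.
- by rewrite wsum_scale -wsum_modl gv wsum_modl.
move=> i i_bnd ig img; rewrite mixed_scale; last by lia.
have modg : g %% m = g by rewrite modn_small //; lia.
apply: d_i.
- rewrite ltn_pmod // andbT lt0n -/(dvdn m _) mulnC coprime_dvd_mul //.
  by rewrite gtnNdvd //; lia.
- apply: contra ig => /eqP e; apply/eqP.
  have : i %% m = g %% m.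
    apply: (coprime_modI vm); rewrite mulnC -[X in X = _]modn_mod e.
    by rewrite mulnC gv; rewrite modn_small //; lia.
  by rewrite modg modn_small //; lia.
- apply: contra img => /eqP e; apply/eqP.
  have : i %% m = (m - g) %% m.
    apply: (coprime_modI vm); rewrite mulnC -[X in X = _]modn_mod e.
    apply/eqP; rewrite -(eqn_modDr j) subnK ?modnn; last by lia.
    rewrite -modnDmr -gv modnDmr mulnC -mulnDl subnK ?modnMr //; lia.
  by rewrite !modn_small //; lia.
Qed.

(** Multiples of [g] see the data only modulo [M]. Geometrically this is the
    quotient of the cover by the subgroup of order [g]. *)
Lemma pure_at_reduce g M d : 0 < g -> pure_at (g * M) g d ->
  pure_at M 1 [seq x %% M | x <- d].
Proof.
move=> g_gt0 [j_bnd d_bnd d_sum d_j d_i].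
have M_gt1 : 1 < M by nia.
split.
- by rewrite M_gt1.
- rewrite all_map; apply: sub_all d_bnd => x /= /andP[_].
  by rewrite dvdn_pmul2l // ltn_pmod ?mul1n //= /dvdn ?modn_mod //; lia.
- have : M %| sumn d by apply: dvdn_trans d_sum; rewrite dvdn_mull.
  by move/(dvdn_wsum 1); rewrite /wsum; under eq_map do rewrite mul1n.
- rewrite wsum_modr; apply/eqP; rewrite -(eqn_pmul2l g_gt0) -wsumMl // muln1 d_j.
  by apply/eqP; lia.
move=> i i_bnd i1 iM; rewrite /mixed !wsum_modr.
have := d_i (g * i); rewrite /mixed -mulnBr !wsumMl // mulnCA !leq_pmul2l //.
by apply; nia.
Qed.

(** * Bounds from the box search *)
Section SearchBounds.
Local Open Scope Z_scope.

Lemma Z_of_modn a m : (0 < m)%N -> Z.of_nat (a %% m) = Z.of_nat a mod Z.of_nat m.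
Proof.
move=> m_gt0; apply: (Z.mod_unique_pos _ _ (Z.of_nat (a %/ m))).
  by have := ltn_pmod a m_gt0; lia.
by rewrite {1}(divn_eq a m) Nat2Z.inj_add Nat2Z.inj_mul; lia.
Qed.

Lemma balanced_mixed m i d (f : nat -> Z) : (0 < m)%N -> (i <= m)%N -> size d = 4%N ->
  (forall x, f x mod Z.of_nat m = Z.of_nat ((i * x) %% m)) ->
  balanced (Z.of_nat m) (map f d) -> mixed m d i.
Proof.
move=> m_gt0 i_le d4 fE /andP[f_ne0 /Z.eqb_eq f_sum].
have wsumE : wsum m d i = (2 * m)%N.
  apply: Nat2Z.inj; rewrite Nat2Z.inj_mul -f_sum /wsum.
  by elim: (d) => //= x d' <-; rewrite fE Nat2Z.inj_add.
have := wsum_opp d m_gt0 i_le; rewrite wsumE /mixed wsumE leqnn /=.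
have -> : count (fun x => ~~ (m %| i * x)%N) d = 4%N.
  rewrite -d4; apply/eqP; rewrite -all_count; move: f_ne0; rewrite all_map.
  by apply: sub_all => x /=; rewrite fE /dvdn; lia.
lia.
Qed.

Lemma in_box_start Q m (c h : nat -> Z) d : 0 < Q ->
  all (fun x => 0 < x < m)%N d -> (forall x, Q * h x = c x * Z.of_nat m) ->
  in_box Q (Z.of_nat m) [seq Cell (c x) 0 Q | x <- d] [seq (h x, Z.of_nat x) | x <- d].
Proof.
move=> Q_gt0 d_bnd hc; elim: d d_bnd => //= x d IHd /andP[x_bnd /IHd d_in].
split=> //; split; first exact: hc.
have -> : (lo (Cell (c x) 0 Q) =? hi (Cell (c x) 0 Q)) = false.
  by apply/Z.eqb_neq; rewrite /lo /hi; lia.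
rewrite /lo /hi /snd; have [x0 xm] : 0 < Z.of_nat x /\ Z.of_nat x < Z.of_nat m by lia.
by nia.
Qed.

Lemma zsum_snd (h : nat -> Z) d :
  zsum (map snd [seq (h x, Z.of_nat x) | x <- d]) = Z.of_nat (sumn d).
Proof. by elim: d => //= x d ->; rewrite Nat2Z.inj_add. Qed.

(** The multipliers [2..11]; the common denominator [27720] is the least common
    multiple of [1..11], so that all cut points are integral. *)
Definition small_tests : seq (Z * Z) := [seq (0, Z.of_nat i) | i <- iota 2 10].

Lemma small_tests_refute :
  refuted 27720 2 small_tests (nseq 4 (Cell 0 0 27720)).
Proof. by vm_cast_no_check (erefl true). Qed.

(** A pair [(a, s)] stands for the multiplier [a * g + s] with [g] unknown: its
    effect on [x] is that of [s], shifted by the known residue of [g * x]. *)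
Definition shift_tests : seq (Z * Z) :=
  [:: (0, 1); (1, 1); (1, -1); (0, 2); (1, 2); (1, -2); (0, 3); (1, 3); (1, -3)].

(** In units of [1 / (6 M)] the residue [y / M] is [6 y], and the tests divide by
    at most [3]. *)
Definition lift_refuted (M : nat) (e : seq nat) (T : Z) : bool :=
  refuted (6 * Z.of_nat M) T shift_tests
    [seq Cell (6 * Z.of_nat y) 0 (6 * Z.of_nat M) | y <- e].
End SearchBounds.

(** Written with [find] and conditionals so that evaluation stops at the first
    mixed index. *)
Definition unmixed (m g : nat) (d : seq nat) : bool :=
  let bad i := if i == g then false else if i == m - g then false else mixed m d i in
  m.-1 <= find bad (iota 1 m.-1).

Fixpoint words (n M : nat) : seq (seq nat) :=
  if n is n'.+1 then [seq x :: w | x <- iota 0 M, w <- words n' M] else [:: [::]].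

(** Each vector of four residues that is pure at [1] modulo some [M <= 12] is fed to
    the search, for each possible value of [sum d / m]. *)
Lemma four_point_lifts_refuted :
  all (fun M => all (fun e =>
         if 0 \in e then true else if sumn e != 2 * M then true
         else if unmixed M 1 e then all (lift_refuted M e) [:: 1; 2; 3]%BZ else true)
       (words 4 M)) (iota 2 11).
Proof. by vm_cast_no_check (erefl true). Qed.

(** Partitions of [t] into parts at most [b], sorted by the multiplicity [c] of the
    part [b]. *)
Fixpoint parts (b t : nat) : seq (seq nat) :=
  if b is b'.+1 then
    flatten [seq [seq nseq c b ++ p | p <- parts b' (t - c * b)]
            | c <- iota 0 (t %/ b).+1]
  else if t == 0 then [:: [::]] else [::].

Fixpoint lifts (g M : nat) (e : seq nat) : seq (seq nat) :=
  if e is y :: e' then [seq (y + M * f) :: w | f <- iota 0 g, w <- lifts g M e']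
  else [:: [::]].

(** One representative from each class, with [m] first and the branch indices
    second. *)
Definition table : seq (nat * seq nat) :=
  [:: (2, [:: 1; 1; 1; 1]);
      (3, [:: 1; 1; 1; 1; 1; 1]); (3, [:: 1; 1; 1; 1; 2]); (3, [:: 1; 1; 2; 2]);
      (4, [:: 1; 1; 1; 1]); (4, [:: 1; 1; 2; 2; 2]); (4, [:: 1; 2; 2; 3]);
      (5, [:: 1; 1; 1; 1; 1]); (5, [:: 1; 1; 1; 2]);
      (6, [:: 1; 1; 1; 3]); (6, [:: 1; 1; 2; 2]); (6, [:: 1; 3; 4; 4]);
      (6, [:: 2; 2; 2; 3; 3]); (6, [:: 2; 3; 3; 4]);
      (7, [:: 1; 1; 1; 4]); (8, [:: 1; 1; 2; 4]); (9, [:: 1; 1; 1; 6]);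
      (10, [:: 1; 2; 2; 5]); (12, [:: 1; 1; 4; 6])].

Definition equiv_data (m : nat) (d d' : seq nat) : bool :=
  has (fun u => coprime u m && perm_eq d' [seq (u * x) %% m | x <- d]) (iota 0 m).

Definition tabulated (m : nat) (d : seq nat) : bool :=
  has (fun r => (r.1 == m) && equiv_data m d r.2) table.

Lemma small_data_tabulated :
  all (fun M => all (fun e =>
         if size e < 4 then true else if ~~ unmixed M 1 e then true
         else all (fun g => all (fun d =>
                if ~~ (g * M %| sumn d) then true
                else if foldr gcdn (g * M) d != 1 then true
                else if unmixed (g * M) g d then tabulated (g * M) d else true)
              (lifts g M e)) [:: 1; 2; 3])
       (parts M.-1 (2 * M))) (iota 2 11).
Proof. by vm_cast_no_check (erefl true). Qed.

(** * Classification of pure data *)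
Lemma unmixedP m g d :
  reflect (forall i, 0 < i < m -> i != g -> i != m - g -> ~~ mixed m d i)
          (unmixed m g d).
Proof.
rewrite /unmixed; set bad := (X in find X _).
rewrite -{1}(size_iota 1 m.-1) leqNgt -has_find; apply: (iffP hasPn) => [h i i_bnd ig img|h i].
  have := h i; rewrite mem_iota /bad (negPf ig) (negPf img); apply; lia.
rewrite mem_iota /bad => i_bnd; case: eqP => // /eqP ig; case: eqP => // /eqP img.
by apply: h; lia.
Qed.

Lemma mem_words M d : all (fun x => x < M) d -> d \in words (size d) M.
Proof.
elim: d => //= x d IHd /andP[x_lt /IHd d_in]; apply/allpairsP.
by exists (x, d); rewrite /= mem_iota.
Qed.

Lemma parts_complete b t d : all (fun x => 0 < x <= b) d -> sumn d = t ->
  exists2 p, p \in parts b t & perm_eq d p.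
Proof.
elim: b t d => [|b IHb] t d d_bnd d_t.
  case: d d_bnd d_t => [_ <-|x d /andP[]]; last by lia.
  by exists [::].
pose d' := [seq x <- d | x != b.+1].
have d_perm : perm_eq d (nseq (count_mem b.+1 d) b.+1 ++ d').
  rewrite -(perm_filterC (pred1 b.+1) d) -/d'.
  suff -> : [seq x <- d | pred1 b.+1 x] = nseq (count_mem b.+1 d) b.+1 by [].
  rewrite -size_filter; apply/all_pred1P; exact: filter_all.
have d_sum : count_mem b.+1 d * b.+1 + sumn d' = t.
  by rewrite -d_t (perm_sumn d_perm) sumn_cat sumn_nseq mulnC.
have [p p_in d'p] : exists2 p, p \in parts b (t - count_mem b.+1 d * b.+1) & perm_eq d' p.
  apply: IHb; last by lia.
  rewrite all_filter; apply: sub_all d_bnd => x /= x_bnd; apply/implyP => x_ne; lia.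
exists (nseq (count_mem b.+1 d) b.+1 ++ p); last first.
  by apply: perm_trans d_perm _; rewrite perm_cat2l.
rewrite [parts _ _]/parts -/parts; apply/flattenP.
exists [seq nseq (count_mem b.+1 d) b.+1 ++ p | p <- parts b (t - count_mem b.+1 d * b.+1)].
  apply/mapP; exists (count_mem b.+1 d) => //; rewrite mem_iota /= add0n ltnS.
  by rewrite leq_divRL // -d_sum leq_addr.
exact: map_f.
Qed.

Lemma mem_lifts g M d : 0 < M -> all (fun x => x < g * M) d ->
  d \in lifts g M [seq x %% M | x <- d].
Proof.
move=> M_gt0; elim: d => //= x d IHd /andP[x_lt /IHd d_in]; apply/allpairsP.
exists (x %/ M, d); split=> //=; first by rewrite mem_iota ltn_divLR.
by rewrite mulnC addnC -divn_eq.
Qed.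

Lemma perm_map_lift (T U : eqType) (f : T -> U) (d : seq T) (s : seq U) :
  perm_eq (map f d) s -> exists2 d', perm_eq d d' & map f d' = s.
Proof.
case: d => [|x0 d0].
  by rewrite perm_sym => /perm_nilP ->; exists [::].
set d := x0 :: d0; rewrite perm_sym => /(perm_iotaP (f x0))[ks ks_perm ->].
rewrite size_map in ks_perm; exists [seq nth x0 d k | k <- ks].
  by rewrite perm_sym; apply/(perm_iotaP x0); exists ks.
rewrite -map_comp; apply/eq_in_map => k; rewrite (perm_mem ks_perm) mem_iota => /andP[_ k_lt].
by rewrite [RHS](nth_map x0).
Qed.

Lemma pure_at_bounds m j d : pure_at m j d -> all (fun x => 0 < x < m) d.
Proof.
case=> _ d_bnd _ _ _; apply: sub_all d_bnd => x /andP[-> h]; rewrite andbT.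
by apply: contraR h; case: x => //; rewrite muln0.
Qed.

(** The tests use the indices [2..11], which differ from [1] and [M - 1] only when
    [M > 12]. *)
Lemma four_point_order_bound M e : size e = 4 -> pure_at M 1 e -> M <= 12.
Proof.
move=> e4 e_pure; rewrite leqNgt; apply/negP => M_gt12.
have e_bnd := pure_at_bounds e_pure; case: e_pure => _ _ _ e_sum e_i.
have sum_e : sumn e = 2 * M.
  rewrite -e_sum /wsum; congr sumn; rewrite -[LHS]map_id; apply/eq_in_map => x x_in.
  by rewrite mul1n modn_small //; have /andP[] := allP e_bnd x x_in.
pose ps := [seq (0%BZ, Z.of_nat x) | x <- e].
have ps_box : in_box 27720 (Z.of_nat M) (nseq 4 (Cell 0 0 27720)) ps.
  have -> : nseq 4 (Cell 0 0 27720) = [seq Cell 0 0 27720 | x <- e].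
    by case: (e) e4 => [|? [|? [|? [|? []]]]].
  exact: (@in_box_start _ _ (fun=> 0%BZ) (fun=> 0%BZ)).
have ps_sum : zsum (map snd ps) = (2 * Z.of_nat M)%BZ.
  by rewrite (zsum_snd (fun=> 0%BZ)) sum_e; lia.
have M_gt0 : (0 < Z.of_nat M)%BZ by lia.
have [t [t_in t_bal]] :=
  refutedP (Pos2Z.is_pos 27720) M_gt0 small_tests_refute ps_box ps_sum.
have [i i_in ti] : exists2 i, 2 <= i < 12 & t = (0%BZ, Z.of_nat i).
  by exists (Z.to_nat t.2); move: t_in; rewrite /=; do 10![case=> [<- //|]].
rewrite {}ti in t_bal.
have : mixed M e i.
  move: t_bal; rewrite /multiples -map_comp; apply: balanced_mixed => //; try lia.
  move=> x; rewrite /= Z_of_modn; last by lia.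
  by rewrite Nat2Z.inj_mul.
by apply/negP/e_i; lia.
Qed.

(** For [g > 3] the tested indices [s], [g + s], [g - s] with [1 <= s <= 3] are not
    multiples of [g], hence differ from [g] and [m - g]. *)
Lemma four_point_index_bound g M d : 0 < g -> size d = 4 -> pure_at (g * M) g d ->
  g <= 3.
Proof.
move=> g_gt0 d4 d_pure; rewrite leqNgt; apply/negP => g_gt3.
have e_pure := pure_at_reduce g_gt0 d_pure; set e := map _ d in e_pure.
have e4 : size e = 4 by rewrite size_map.
have M_le := four_point_order_bound e4 e_pure.
have e_bnd := pure_at_bounds e_pure; have d_bnd := pure_at_bounds d_pure.
have M_gt1 : 1 < M by case: e_pure => /andP[].
have : all (lift_refuted M e) [:: 1; 2; 3]%BZ.
  have M_in : M \in iota 2 11 by rewrite mem_iota; lia.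
  have {M_in} := allP four_point_lifts_refuted M M_in => /allP /(_ e).
  have e_ltM : all (fun x => x < M) e by apply: sub_all e_bnd => x /andP[].
  rewrite -e4 mem_words // => /(_ isT).
  have -> : (0 \in e) = false by apply/negP => /(allP e_bnd).
  case: e_pure => _ _ _ e_sum /unmixedP ->.
  suff -> : sumn e = 2 * M by rewrite eqxx.
  rewrite -e_sum /wsum; congr sumn; rewrite -[LHS]map_id; apply/eq_in_map => x x_in.
  by rewrite mul1n modn_small //; have /andP[] := allP e_bnd x x_in.
case: d_pure => _ _ /dvdnP[T d_sum] d_j d_i.
have T_bnd : 0 < T <= 3.
  case: (d) d4 d_bnd d_sum => [|a [|b [|c [|f []]]]] //= _; nia.
case/and4P=> e_ref1 e_ref2 e_ref3 _.
have {e_ref1 e_ref2 e_ref3} : lift_refuted M e (Z.of_nat T).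
  case: T T_bnd {d_sum} => [|[|[|[|T]]]] T_bnd; first by lia.
  - exact: e_ref1.
  - exact: e_ref2.
  - exact: e_ref3.
  by lia.
rewrite /lift_refuted -map_comp => e_ref.
pose h x := Z.of_nat (g * (x %% M)).
have gM_gt0 : 0 < g * M by nia.
have Q_gt0 : (0 < 6 * Z.of_nat M)%BZ by lia.
have m_gt0 : (0 < Z.of_nat (g * M))%BZ by lia.
have ps_box := @in_box_start (6 * Z.of_nat M) (g * M) (fun x => 6 * Z.of_nat (x %% M))%BZ h
  d Q_gt0 d_bnd ltac:(by move=> x; rewrite /h; lia).
have ps_sum : zsum (map snd [seq (h x, Z.of_nat x) | x <- d]) =
              (Z.of_nat T * Z.of_nat (g * M))%BZ.
  by rewrite zsum_snd d_sum; lia.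
have [t [t_in]] := refutedP Q_gt0 m_gt0 e_ref ps_box ps_sum.
rewrite /multiples -map_comp => t_bal.
have [i [i_bnd ig img iE]] : exists i, [/\ 0 < i < g * M, i != g, i != g * M - g &
    Z.of_nat i = (t.1 * Z.of_nat g + t.2)%BZ].
  (* [m - g] is [g] itself or at least [2 * g], which is beyond [g + 3]. *)
  have gM : g * M = 2 * g \/ 3 * g <= g * M.
    have [M2|M_gt2] : M = 2 \/ 2 < M by lia.
      by left; rewrite M2 mulnC.
    by right; rewrite mulnC leq_mul2l M_gt2 orbT.
  exists (Z.to_nat (t.1 * Z.of_nat g + t.2)%BZ).
  move: gM; move: (g * M) => m gM.
  move: t_in; rewrite [In _ _]/=; do 9![case; first by move=> <-; rewrite /fst /snd; split; lia].
  by [].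
suff : mixed (g * M) d i by apply/negP/d_i.
move: t_bal; apply: balanced_mixed => //; first by lia.
move=> x /=.
rewrite Z_of_modn //.
have -> : Z.of_nat (i * x) = (t.1 * h x + t.2 * Z.of_nat x +
   (t.1 * Z.of_nat (x %/ M)) * Z.of_nat (g * M))%BZ.
  have ex : Z.of_nat x = (Z.of_nat (x %/ M) * Z.of_nat M + Z.of_nat (x %% M))%BZ.
    by rewrite {1}(divn_eq x M); lia.
  by rewrite /h !Nat2Z.inj_mul iE ex; ring.
by rewrite Z_mod_plus_full.
Qed.

Lemma dvdn_foldr_gcdn c m d : (c %| foldr gcdn m d) = (c %| m) && all (dvdn c) d.
Proof. by elim: d => [|x d IHd] /=; rewrite ?andbT // dvdn_gcd IHd andbCA. Qed.

Lemma perm_foldr_gcdn m d d' : perm_eq d d' -> foldr gcdn m d = foldr gcdn m d'.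
Proof.
move=> dd'; have h c : (c %| foldr gcdn m d) = (c %| foldr gcdn m d').
  by rewrite !dvdn_foldr_gcdn (perm_all _ dd').
by apply/eqP; rewrite eqn_dvd -h dvdnn h dvdnn.
Qed.

Lemma foldr_gcdn_scale m v d : coprime v m -> foldr gcdn m d = 1 ->
  foldr gcdn m [seq (v * x) %% m | x <- d] = 1.
Proof.
move=> vm d1; apply/eqP; rewrite -dvdn1 -d1 dvdn_foldr_gcdn.
set c := foldr _ _ _; have : c %| c by [].
rewrite {2}/c dvdn_foldr_gcdn => /andP[cm]; rewrite all_map cm => c_vd /=.
apply: sub_all c_vd => x /= c_vx; have : c %| v * x.
  by rewrite (divn_eq (v * x) m) dvdn_addr // dvdn_mull.
by rewrite Gauss_dvdr // coprime_sym; apply: coprime_dvdr vm.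
Qed.

Lemma equiv_dataI m u d d' : 0 < m -> coprime u m ->
  perm_eq d' [seq (u * x) %% m | x <- d] -> equiv_data m d d'.
Proof.
move=> m_gt0 um d'_perm; apply/hasP; exists (u %% m).
  by rewrite mem_iota ltn_pmod.
rewrite coprime_modl um; congr perm_eq: d'_perm; apply: eq_map => x.
by rewrite modnMml.
Qed.

(** The bounds on [M] and [g] come from a four-point degeneration of the data; they
    hold for the data themselves because degeneration keeps [m] and [j]. *)
Theorem pure_data_tabulated m j d : 4 <= size d -> pure_at m j d ->
  foldr gcdn m d = 1 -> tabulated m d.
Proof.
move=> d_ge4 d_pure d_gcd.
have [m_gt0 j_gt0] : 0 < m /\ 0 < j by case: d_pure; lia.
have [v vm] := pure_at_normalize d_pure; set d1 := map _ d => d1_pure.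
set g := gcdn j m in d1_pure; have g_gt0 : 0 < g by rewrite gcdn_gt0 j_gt0.
have [M em] : exists M, m = g * M.
  by exists (m %/ g); rewrite mulnC divnK ?dvdn_gcdr.
have d1_ge4 : 4 <= size d1 by rewrite size_map.
have d1_gcd : foldr gcdn m d1 = 1 by apply: foldr_gcdn_scale.
have [M_le g_le] : M <= 12 /\ g <= 3.
  have [d4 d4_size d4_pure] := pure_at_four d1_ge4 d1_pure.
  rewrite em in d4_pure; split; last exact: four_point_index_bound d4_pure.
  by apply: four_point_order_bound (pure_at_reduce g_gt0 d4_pure); rewrite size_map.
have e1_pure : pure_at M 1 [seq x %% M | x <- d1].
  by apply: (pure_at_reduce g_gt0); rewrite -em.
have e1_bnd := pure_at_bounds e1_pure.
have M_gt1 : 1 < M by case: e1_pure => /andP[].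
have [s s_in e1s] : exists2 s, s \in parts M.-1 (2 * M) & perm_eq [seq x %% M | x <- d1] s.
  apply: parts_complete; first by apply: sub_all e1_bnd => x; lia.
  case: e1_pure => _ _ _ <- _; rewrite /wsum; congr sumn; rewrite -[LHS]map_id.
  apply/eq_in_map => x x_in; rewrite mul1n modn_small //.
  by have /andP[] := allP e1_bnd x x_in.
have [d2 d12 e2s] := perm_map_lift e1s.
have d2_pure := perm_pure_at d12 d1_pure; rewrite em in d2_pure.
have d2_bnd := pure_at_bounds d2_pure.
have d2_in : d2 \in lifts g M s.
  by rewrite -e2s; apply: mem_lifts; [lia | apply: sub_all d2_bnd => x /andP[]].
have s_pure := perm_pure_at e1s e1_pure.
have : tabulated (g * M) d2.
  have M_in : M \in iota 2 11 by rewrite mem_iota; lia.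
  have g_in : g \in [:: 1; 2; 3] by rewrite !inE; lia.
  have := allP small_data_tabulated M M_in => /allP /(_ s s_in).
  rewrite -(perm_size e1s) size_map ltnNge d1_ge4.
  have -> : unmixed M 1 s by case: s_pure => _ _ _ _ /unmixedP.
  move=> /allP /(_ g g_in) /allP /(_ d2 d2_in).
  case: d2_pure => _ _ -> _ /unmixedP -> /=.
  by rewrite -em -(perm_foldr_gcdn _ d12) d1_gcd eqxx.
rewrite -em => /hasP[r r_in /andP[rm /hasP[u _ /andP[um r_perm]]]].
apply/hasP; exists r => //; rewrite rm /=.
apply: (@equiv_dataI m (u * v)) => //; first by rewrite coprimeMl um.
apply: perm_trans r_perm _; rewrite perm_sym.
apply: perm_trans (perm_map _ d12); rewrite /d1 -map_comp.
apply: (eq_ind _ (perm_eq _) (perm_refl _)).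
by apply: eq_map => x /=; rewrite modnMmr mulnA.
Qed.

Definition is_pure (m : nat) (d : seq nat) : bool :=
  has (fun j => (wsum m d j == 2 * m) && unmixed m j d &&
                all (fun x => (x < m) && ~~ (m %| j * x)) d) (iota 1 m.-1).

Lemma table_data : all (fun r : nat * seq nat =>
  [&& 4 <= size r.2, r.1 %| sumn r.2, foldr gcdn r.1 r.2 == 1 & is_pure r.1 r.2]) table.
Proof. by vm_cast_no_check (erefl true). Qed.

Lemma table_inequivalent : all (fun i => all (fun k =>
  let r := nth (0, [::]) table i in let r' := nth (0, [::]) table k in
  (i == k) || ~~ ((r.1 == r'.1) && equiv_data r.1 r.2 r'.2)) (iota 0 19)) (iota 0 19).
Proof. by vm_cast_no_check (erefl true). Qed.

Lemma is_pureP m d : m %| sumn d -> is_pure m d -> exists j, pure_at m j d.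
Proof.
move=> d_sum /hasP[j]; rewrite mem_iota => j_in /andP[/andP[/eqP d_j /unmixedP d_i] d_bnd].
by exists j; split=> //; lia.
Qed.

Local Open Scope ring_scope.
Local Open Scope complex_scope.

(** * Growth of rational functions at a point *)
Section OrderAtZero.
Variable C : numClosedFieldType.
Implicit Types (f g : C -> C) (n k : int) (P : {poly C}).

(** Two-sided bounds by a power of [|t|] on a punctured disc, which is all that is
    needed to decide boundedness, and which products, powers and inverses
    respect. *)
Definition has_order f n : Prop := exists r A B : C,
  [/\ 0 < r, 0 < A, 0 < B & forall t, 0 < `|t| < r ->
      A * `|t| ^ n <= `|f t| <= B * `|t| ^ n].

Lemma common_radius (r s : C) : 0 < r -> 0 < s ->
  exists u, [/\ 0 < u, u <= r & u <= s].
Proof.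
move=> r_gt0 s_gt0; case: (real_leP (gtr0_real r_gt0) (gtr0_real s_gt0)) => [rs|sr].
  by exists r.
by exists s; split=> //; apply: ltW.
Qed.

Lemma has_order_eq f g n : (forall t, t != 0 -> f t = g t) ->
  has_order f n -> has_order g n.
Proof.
move=> fg [r [A [B [r0 A0 B0 h]]]]; exists r, A, B; split=> // t /[dup] t_bnd /h.
by rewrite fg // -normr_gt0; case/andP: t_bnd.
Qed.

Lemma has_orderM f g n k : has_order f n -> has_order g k ->
  has_order (fun t => f t * g t) (n + k).
Proof.
move=> [r [A [B [r0 A0 B0 hf]]]] [s [A' [B' [s0 A'0 B'0 hg]]]].
have [u [u0 ur us]] := common_radius r0 s0.
exists u, (A * A'), (B * B'); split; rewrite ?mulr_gt0 // => t /andP[t0 tu].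
have /andP[f1 f2] := hf t ltac:(by rewrite t0 (lt_le_trans tu)).
have /andP[g1 g2] := hg t ltac:(by rewrite t0 (lt_le_trans tu)).
have tn0 : `|t| != 0 by rewrite gt_eqF.
rewrite normrM expfzDr // mulrACA [B * B' * _]mulrACA.
have p1 : 0 <= A * `|t| ^ n by rewrite mulr_ge0 ?exprz_ge0 // ltW.
have p2 : 0 <= A' * `|t| ^ k by rewrite mulr_ge0 ?exprz_ge0 // ltW.
by rewrite !ler_pM.
Qed.

Lemma has_orderV f n : has_order f n -> has_order (fun t => (f t)^-1) (- n).
Proof.
move=> [r [A [B [r0 A0 B0 hf]]]]; exists r, B^-1, A^-1.
split; rewrite ?invr_gt0 // => t t_bnd; have /andP[f1 f2] := hf t t_bnd.
have tn0 : 0 < `|t| by case/andP: t_bnd.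
have p1 : 0 < A * `|t| ^ n by rewrite mulr_gt0 ?exprz_gt0.
have f0 : 0 < `|f t| by apply: lt_le_trans f1.
by rewrite normfV -invr_expz -!invfM !lef_pV2 ?posrE ?f1 ?f2 ?mulr_gt0 ?exprz_gt0.
Qed.

Lemma has_order_cst (c : C) : c != 0 -> has_order (fun=> c) 0.
Proof.
move=> c0; exists 1, `|c|, `|c|; rewrite !normr_gt0 ltr01; split=> // t _.
by rewrite expr0z mulr1 lexx.
Qed.

Lemma has_order_id : has_order id 1.
Proof. by exists 1, 1, 1; rewrite ltr01; split=> // t _; rewrite expr1z mul1r lexx. Qed.

Lemma has_orderX f n i : has_order f n -> has_order (fun t => f t ^+ i) (n * i%:Z).
Proof.
move=> fn; elim: i => [|i IHi].
  rewrite mulr0; apply: (has_order_eq _ (has_order_cst (oner_neq0 C))) => t _.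
  by rewrite expr0.
rewrite intS mulrDr mulr1; apply: (has_order_eq _ (has_orderM fn IHi)) => t _.
by rewrite exprS.
Qed.

(** Near [0] the value [P.[t]] stays within [|P.[0]| / 2] of [P.[0]]. *)
Lemma has_order_horner P : P.[0] != 0 -> has_order (horner P) 0.
Proof.
move=> P0; pose p0 := P.[0].
have [S PE] : exists S, P = S * 'X + p0%:P.
  have : root (P - p0%:P) 0 by rewrite /root !hornerE subrr.
  move/factor_theorem=> [S]; rewrite subr0 => PS; exists S.
  by rewrite -PS subrK.
(* [K] bounds the quotient [(P.[t] - P.[0]) / t] on the unit disc. *)
pose K := 1 + \sum_(i < size S) `|S`_i|.
have K0 : 0 < K by rewrite ltr_pwDl // sumr_ge0.
have S_le t : `|t| <= 1 -> `|S.[t]| <= K.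
  move=> t1; rewrite horner_coef (le_trans (ler_norm_sum _ _ _)) //.
  apply: le_trans (_ : \sum_(i < size S) `|S`_i| <= _); last by rewrite lerDr.
  apply: ler_sum => i _; rewrite normrM normrX ler_piMr // exprn_ile1 //.
have p0_gt0 : 0 < `|p0| by rewrite normr_gt0.
have [r [r0 r1 r2]] := @common_radius 1 (`|p0| / (2 * K)) ltr01
  ltac:(by rewrite divr_gt0 ?mulr_gt0).
exists r, (`|p0| / 2), (`|p0| * 2); split; rewrite ?divr_gt0 ?mulr_gt0 // => t /andP[_ tr].
rewrite expr0z !mulr1.
have dist : `|P.[t] - p0| <= `|p0| / 2.
  rewrite PE !hornerE addrK normrM.
  have -> : `|p0| / 2 = K * (`|p0| / (2 * K)) by field; rewrite gt_eqF.
  rewrite ler_pM // ?S_le // ltW // ?(lt_le_trans tr) //.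
apply/andP; split.
  have := lerB_dist p0 (p0 - P.[t]); rewrite subKr distrC => h.
  apply: le_trans h; rewrite lerBrDl.
  by apply: le_trans (_ : `|p0| / 2 + `|p0| / 2 <= _); [rewrite lerD2r | rewrite -splitr].
have -> : P.[t] = (P.[t] - p0) + p0 by rewrite subrK.
apply: le_trans (ler_normD _ _) _; rewrite mulr_natr mulr2n lerD2r.
by apply: le_trans dist _; rewrite ler_pdivrMr // ler_peMr // ler1n.
Qed.

Lemma bounded_has_order f n : has_order f n ->
  (exists r M : C, 0 < r /\ forall t, 0 < `|t| < r -> `|f t| <= M) <-> 0 <= n.
Proof.
move=> [r [A [B [r0 A0 B0 hf]]]]; split; last first.
  move=> n0; have [u [u0 ur u1]] := common_radius r0 ltr01.
  exists u, B; split=> // t /andP[t0 tu].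
  have /andP[_ f2] := hf t ltac:(by rewrite t0 (lt_le_trans tu)).
  apply: le_trans f2 _; rewrite ler_piMr ?(ltW B0) //.
  case: n n0 {hf} => // n _; rewrite -exprnP exprn_ile1 //.
  by rewrite ltW // (lt_le_trans tu).
move=> [s [M [s0 fM]]]; case: n hf => // k hf; exfalso.
have [u [u0 ur us]] := common_radius r0 s0.
have M'0 : 0 < `|M| + 1 by rewrite ltr_wpDl.
have [w [w0 w1 wM]] := @common_radius 1 (A / (`|M| + 1)) ltr01 ltac:(by rewrite divr_gt0).
have [v [v0 vu vw]] := common_radius u0 w0.
(* At a small real [t] the lower bound [A / t ^+ k.+1] exceeds the given [M]. *)
pose t := v / 2; have t0 : 0 < t by rewrite divr_gt0.
have tv : t < v by rewrite /t ltr_pdivrMr // mulr_natr mulr2n ltrDl.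
have tE : `|t| = t by rewrite gtr0_norm.
have t_r : 0 < `|t| < r by rewrite tE t0 (lt_le_trans tv) // (le_trans vu).
have t_s : 0 < `|t| < s by rewrite tE t0 (lt_le_trans tv) // (le_trans vu).
have /andP[f1 _] := hf t t_r; have f2 := fM t t_s.
have : A * `|t| ^ Negz k <= `|M|.
  apply: le_trans f1 _; rewrite [`|M|]ger0_norm //; exact: le_trans f2.
rewrite NegzE -invr_expz tE -exprnP ler_pdivrMr ?exprn_gt0 // => A_le.
suff /lt_le_trans/(_ A_le) : `|M| * t ^+ k.+1 < A by rewrite ltxx.
apply: (@le_lt_trans _ _ (`|M| * t)).
  rewrite ler_wpM2l // exprS ler_piMr ?(ltW t0) // exprn_ile1 ?(ltW t0) //.
  by rewrite ltW // (lt_le_trans tv) // (le_trans vw).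
have : t < A / (`|M| + 1) by rewrite (lt_le_trans tv) // (le_trans vw).
rewrite ltr_pdivlMr // => h; apply: le_lt_trans h; rewrite mulrC ler_pM2l //.
by rewrite lerDl.
Qed.

Lemma mup_factor (b : C) P : P != 0 ->
  exists2 Q, ~~ root Q b & P = Q * ('X - b%:P) ^+ mup b P.
Proof.
move=> P0; have := leqnn (mup b P); rewrite mup_geq // => /dvdpP[Q PE].
exists Q => //; apply/negP => /factor_theorem[S QS].
have : ('X - b%:P) ^+ (mup b P).+1 %| P by rewrite {2}PE QS -mulrA -exprS dvdp_mull.
by rewrite -mup_geq // ltnn.
Qed.

Lemma has_order_finite_chart (b : C) e P : (0 < e)%N -> P != 0 ->
  has_order (fun t => P.[b + t ^+ e]) (e%:Z * (mup b P)%:Z).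
Proof.
move=> e0 P0; have [Q Qb PE] := mup_factor b P0.
pose Q1 := Q \Po (b%:P + 'X^e).
have Q1_0 : Q1.[0] != 0.
  by rewrite horner_comp !hornerE expr0n gtn_eqF // addr0.
have := has_orderM (has_orderX (mup b P) (has_orderX e has_order_id))
  (has_order_horner Q1_0).
rewrite mul1r addr0; apply: has_order_eq => t _.
by rewrite [in RHS]PE horner_comp !hornerE (addrC b) addrK mulrC.
Qed.

(** [t^(e deg P) P(t^-e)] is the value at [t^e] of the reversed polynomial, whose
    constant coefficient is the leading coefficient of [P]. *)
Lemma has_order_infinite_chart e P : (0 < e)%N -> P != 0 ->
  has_order (fun t => P.[t ^- e]) (e%:Z * - (size P).-1%:Z).
Proof.
move=> e0 P0; pose d := (size P).-1.
have dP : size P = d.+1 by rewrite prednK // lt0n size_poly_eq0.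
pose Q := \poly_(k < d.+1) P`_(d - k); pose Q1 := Q \Po 'X^e.
have Q1_0 : Q1.[0] != 0.
  rewrite horner_comp hornerXn expr0n gtn_eqF // horner_coef0 coef_poly /= subn0.
  by rewrite -lead_coefE lead_coef_eq0.
have := has_orderM (has_orderV (has_orderX d (has_orderX e has_order_id)))
    (has_order_horner Q1_0).
rewrite mul1r addr0 mulrN; apply: has_order_eq => t t0.
have te0 : t ^+ e != 0 by rewrite expf_neq0.
rewrite horner_comp hornerXn horner_poly horner_coef dP mulr_sumr.
rewrite [RHS](reindex_inj rev_ord_inj) /=; apply: eq_bigr => k _.
have kd : (k <= d)%N by rewrite -ltnS.
rewrite subSS mulrCA; congr (_ * _).
by rewrite exprVn -{1}(subnK kd) exprD invfM -mulrA mulVf ?mulr1 // expf_neq0.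
Qed.

Lemma dvdp_mup P W : P != 0 -> W != 0 ->
  (forall b, (mup b W <= mup b P)%N) -> W %| P.
Proof.
elim/ltn_ind: {W}(size W) {-2}W (erefl (size W)) P => n IHn W Wn P P0 W0 le_mup.
have [W1|W1] := eqVneq (size W) 1%N.
  by move/eqP: W1; rewrite size_poly_eq1 => /eqp_dvdl ->; rewrite dvd1p.
have [b /factor_theorem[W' WE]] := closed_rootP _ W1.
have W'0 : W' != 0 by apply: contraNneq W0 => W'0; rewrite WE W'0 mul0r.
have [P' PE] : exists P', P = P' * ('X - b%:P).
  apply: factor_theorem; rewrite -dvdp_XsubCl -['X - _]expr1 -mup_geq //.
  by apply: leq_trans (le_mup b); rewrite mup_geq // expr1 WE dvdp_mull.
have P'0 : P' != 0 by apply: contraNneq P0 => P'0; rewrite PE P'0 mul0r.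
have X0 : 'X - b%:P != 0 by rewrite polyXsubC_eq0.
rewrite WE PE dvdp_mul2r //; apply: (IHn _ _ _ (erefl _)) => // [|c].
  by rewrite -Wn WE size_Mmonic ?monicXsubC // size_XsubC addn2.
by have := le_mup c; rewrite WE PE !mupM // leq_add2r.
Qed.

End OrderAtZero.

(** * Holomorphic forms in a given power of y *)
Section FractionRepr.
Local Open Scope quotient_scope.

Lemma frac_reprE (A : idomainType) (h : {fraction A}) :
  h * FracField.tofrac (frac (repr h)).2 = FracField.tofrac (frac (repr h)).1.
Proof.
rewrite -{1}[h]reprK; move: (repr h) => x.
rewrite !piE.
apply/eqmodP; rewrite /= FracField.equivfE /FracField.mulf /=.
have := denom_ratioP x => x0.
by rewrite !numden_Ratio ?mulf_neq0 ?oner_neq0 // !mulr1 mulrC.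
Qed.

Lemma frac_repr_neq0 (A : idomainType) (h : {fraction A}) :
  h != 0 -> (frac (repr h)).1 != 0.
Proof.
move=> h0; rewrite -tofrac_eq0 -frac_reprE mulf_neq0 // tofrac_eq0.
exact: denom_ratioP.
Qed.

Lemma tofrac_div_eq (A : idomainType) (n d P W : A) : d != 0 -> W != 0 ->
  FracField.tofrac n / FracField.tofrac d = FracField.tofrac P / FracField.tofrac W <->
  n * W = P * d.
Proof.
move=> d0 W0; split=> [/eqP|PE].
  by rewrite eqr_div ?tofrac_eq0 // -!rmorphM /= tofrac_eq => /eqP.
by apply/eqP; rewrite eqr_div ?tofrac_eq0 // -!rmorphM /= PE.
Qed.

Lemma frac_repr_div (A : idomainType) (h : {fraction A}) :
  h = FracField.tofrac (frac (repr h)).1 / FracField.tofrac (frac (repr h)).2.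
Proof. by rewrite -frac_reprE mulfK // tofrac_eq0 denom_ratioP. Qed.

End FractionRepr.

Lemma bd_m_clears D : clears_denominators D (bd_m D).
Proof. by rewrite /bd_m; case: ex_minnP. Qed.

Lemma bd_m_gt0 D : (0 < bd_m D)%N.
Proof. by have /andP[] := bd_m_clears D. Qed.

Lemma bd_dE D k : (bd_d D k)%:R = (bd_m D)%:R * bd_mu D k :> rat.
Proof.
have /andP[_ /forallP/(_ k) mk] := bd_m_clears D.
rewrite /bd_d truncnK // natrEint mk mulr_ge0 // ltW //.
by have /andP[] := bd_mu_bounds k.
Qed.

Section LocalCondition.
Variables (R : realType) (D : branch_data) (a : 'I_(bd_n D).+3 -> P1 R).
Local Notation C := R[i].
Local Notation m := (bd_m D).

Definition branch_index (p : P1 R) : nat := (\sum_(k | a k == p) bd_d D k)%N.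

Lemma ramification_gt0 p : (0 < ramification a p)%N.
Proof.
by rewrite /ramification divn_gt0 ?gcdn_gt0 ?bd_m_gt0 // dvdn_leq ?bd_m_gt0 ?dvdn_gcdl.
Qed.

Definition poly_order (p : P1 R) (P : {poly C}) : int :=
  if p is Some b then (mup b P)%:Z else - (size P).-1%:Z.

Definition dx_order (p : P1 R) : int :=
  let e := ramification a p in if p is Some _ then e%:Z - 1 else - (e%:Z + 1).

Lemma has_order_chart_x p (P : {poly C}) : P != 0 ->
  has_order (fun t => P.[chart_x a p t]) ((ramification a p)%:Z * poly_order p P).
Proof.
have e0 := ramification_gt0 p; case: p e0 => [b|] e0 P0.
  exact: has_order_finite_chart.
exact: has_order_infinite_chart.
Qed.

Lemma has_order_chart_dx p : has_order (chart_dx a p) (dx_order p).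
Proof.
have e0 := ramification_gt0 p; rewrite /chart_dx /dx_order.
case: p e0 => [b|] e0; set e := ramification _ _ in e0 *.
  have := has_orderM (has_order_cst (_ : e%:R != 0 :> C)) (has_orderX e.-1 (has_order_id _)).
  by rewrite pnatr_eq0 -lt0n => /(_ e0); rewrite add0r mul1r predn_int.
have := has_orderM (has_order_cst (_ : - e%:R != 0 :> C))
  (has_orderV (has_orderX e.+1 (has_order_id _))).
rewrite oppr_eq0 pnatr_eq0 -lt0n => /(_ e0); rewrite add0r mul1r intS addrC.
by apply: has_order_eq => t _; rewrite mulNr.
Qed.

Lemma eval_frac0 x : eval_frac (0 : {fraction {poly C}}) x = 0.
Proof.
rewrite /eval_frac; suff -> : (frac (repr (0 : {fraction {poly C}}))).1 = 0.
  by rewrite horner0 mul0r.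
by apply/eqP; rewrite -tofrac_eq0 -frac_reprE mul0r.
Qed.

Lemma eval_formZXn (h : {fraction {poly C}}) i x y : h != 0 ->
  eval_form (h *: 'X^i) x y = eval_frac h x * y ^+ i.
Proof.
move=> h0; rewrite /eval_form size_scale // size_polyXn big_ord_recr /=.
rewrite coefZ coefXn eqxx mulr1 big1 ?add0r // => k _.
by rewrite coefZ coefXn ltn_eqF ?ltn_ord // mulr0 eval_frac0 mul0r.
Qed.

Lemma cover_poly_neq0 : cover_poly a != 0.
Proof.
rewrite /cover_poly; apply/prodf_neq0 => k _.
by case: (a k) => [b|]; rewrite ?oner_neq0 // expf_neq0 // polyXsubC_eq0.
Qed.

(** Boundedness can be tested on the [m]-th power, where [y^m] is replaced by the
    value of [cover_poly]; the power is a function of [t] alone, with an explicit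
    order at [0]. *)
Lemma holomorphic_overE (h : {fraction {poly C}}) i p : h != 0 ->
  let num := (frac (repr h)).1 in let den := (frac (repr h)).2 in
  num != 0 -> den != 0 ->
  holomorphic_over a (h *: 'X^i) p <->
  0 <= ((ramification a p)%:Z * poly_order p num +
        - ((ramification a p)%:Z * poly_order p den) + dx_order p) * m%:Z
       + (ramification a p)%:Z * poly_order p (cover_poly a) * i%:Z.
Proof.
move=> h0 num den num0 den0.
have m0 := bd_m_gt0 D.
pose x := chart_x a p; pose f t := (num.[x t] / den.[x t] * chart_dx a p t) ^+ m *
  (cover_poly a).[x t] ^+ i.
have f_ord : has_order f (((ramification a p)%:Z * poly_order p num +
        - ((ramification a p)%:Z * poly_order p den) + dx_order p) * m%:Z
       + (ramification a p)%:Z * poly_order p (cover_poly a) * i%:Z).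
  apply: has_orderM; apply: has_orderX; last exact: has_order_chart_x cover_poly_neq0.
  apply: has_orderM (has_order_chart_dx p).
  by apply: has_orderM (has_orderV _); exact: has_order_chart_x.
rewrite -(bounded_has_order f_ord) /holomorphic_over.
have fE t y : y ^+ m = (cover_poly a).[chart_x a p t] ->
    (eval_form (h *: 'X^i) (chart_x a p t) y * chart_dx a p t) ^+ m = f t.
  move=> ym; rewrite eval_formZXn // /f -ym -exprM mulnC exprM -exprMn.
  by rewrite /eval_frac mulrAC.
split=> -[r [M [r0 hM]]].
  exists r, (M ^+ m); split=> // t t_bnd.
  have ym : (m.-root (cover_poly a).[chart_x a p t]) ^+ m = (cover_poly a).[chart_x a p t].
    exact: rootCK.
  have hM' := hM t _ t_bnd ym.
  by rewrite -(fE t _ ym) normrX lerXn2r // nnegrE ?(le_trans _ hM').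
exists r, (1 + M); split=> // t y t_bnd ym.
have fM := hM t t_bnd.
have M0 : 0 <= M by apply: le_trans fM.
rewrite -(ler_pXn2r m0) ?nnegrE ?addr_ge0 // -normrX (fE t y ym).
apply: le_trans fM _; apply: le_trans (_ : 1 + M <= _); first by rewrite lerDr.
by rewrite ler_eXnr // lerDl.
Qed.

End LocalCondition.

(** With [m = g e] and branch index [g D'], the exponent is divisible by [m]; the
    quotient is an integer, so [0 <= z - 1] may be replaced by [0 < g z]. The
    degree version below uses in addition that the finite branch indices [F] and
    the one at infinity add up to a multiple of [m]. *)
Lemma finite_pole_bound (e g D' alpha beta i : nat) : (0 < e)%N -> (0 < g)%N ->
  0 <= (e%:Z * alpha%:Z + - (e%:Z * beta%:Z) + (e%:Z - 1)) * (g * e)%N%:Z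
       + e%:Z * (g * D')%N%:Z * i%:Z
  <-> (beta * (g * e) < i * (g * D') + alpha * (g * e) + g * e)%N.
Proof.
move=> e0 g0; have ge0 : 0 < (g * e)%N%:Z by rewrite ltz_nat muln_gt0 g0.
set z : int := e%:Z * (alpha%:Z - beta%:Z) + e%:Z + i%:Z * D'%:Z.
have -> : (e%:Z * alpha%:Z + - (e%:Z * beta%:Z) + (e%:Z - 1)) * (g * e)%N%:Z
    + e%:Z * (g * D')%N%:Z * i%:Z = (z - 1) * (g * e)%N%:Z.
  by rewrite /z !PoszM; ring.
rewrite pmulr_lge0 // subr_ge0 -ltz_nat -subr_gt0.
have -> : (i * (g * D') + alpha * (g * e) + g * e)%N%:Z - (beta * (g * e))%N%:Z = g%:Z * z.
  by rewrite /z !PoszD !PoszM; ring.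
by rewrite pmulr_rgt0.
Qed.

Lemma infinite_pole_bound (e g D' F T dn dd i : nat) : (0 < e)%N -> (0 < g)%N ->
  (F + g * D' = T * (g * e))%N ->
  0 <= (e%:Z * - dn%:Z + - (e%:Z * - dd%:Z) + - (e%:Z + 1)) * (g * e)%N%:Z
       + e%:Z * - F%:Z * i%:Z
  <-> ((dn + 2 + i * T) * (g * e) < i * (g * D') + dd * (g * e) + g * e)%N.
Proof.
move=> e0 g0 FE; have ge0 : 0 < (g * e)%N%:Z by rewrite ltz_nat muln_gt0 g0.
have {}FE : F%:Z = T%:Z * (g%:Z * e%:Z) - g%:Z * D'%:Z.
  by rewrite -!PoszM -FE PoszD addrK.
set z : int := e%:Z * (dd%:Z - dn%:Z) - e%:Z - e%:Z * T%:Z * i%:Z + i%:Z * D'%:Z.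
have -> : (e%:Z * - dn%:Z + - (e%:Z * - dd%:Z) + - (e%:Z + 1)) * (g * e)%N%:Z
       + e%:Z * - F%:Z * i%:Z = (z - 1) * (g * e)%N%:Z.
  by rewrite FE /z !PoszM; ring.
rewrite pmulr_lge0 // subr_ge0 -ltz_nat -subr_gt0.
have -> : (i * (g * D') + dd * (g * e) + g * e)%N%:Z - ((dn + 2 + i * T) * (g * e))%N%:Z
    = g%:Z * z.
  by rewrite /z !PoszD !PoszM !PoszD !PoszM; ring.
by rewrite pmulr_rgt0.
Qed.

Definition ceil_div (m x : nat) : nat := ((x + m.-1) %/ m)%N.

Lemma ceil_divP m x y z : (0 < m)%N ->
  (y <= z + ceil_div m x)%N = (y * m < x + z * m + m)%N.
Proof.
by move=> m0; rewrite /ceil_div -divnMDl // leq_divRL //; lia.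
Qed.

Lemma ceil_div0 m : (0 < m)%N -> ceil_div m 0 = 0%N.
Proof. by move=> m0; rewrite /ceil_div add0n divn_small // prednK. Qed.

Section Holomorphic.
Variables (R : realType) (D : branch_data) (a : 'I_(bd_n D).+3 -> P1 R).
Hypothesis a_inj : injective a.
Local Notation C := R[i].
Local Notation m := (bd_m D).

(** For [c = bd_d D] this is [cover_poly]. *)
Definition finite_prod (c : 'I_(bd_n D).+3 -> nat) : {poly C} :=
  \prod_k (if a k is Some b then ('X - b%:P) ^+ c k else 1).

Lemma finite_prod_neq0 c : finite_prod c != 0.
Proof.
apply/prodf_neq0 => k _.
by case: (a k) => [b|]; rewrite ?oner_neq0 // expf_neq0 // polyXsubC_eq0.
Qed.

Lemma mup_finite_prod c b : mup b (finite_prod c) = (\sum_(k | a k == Some b) c k)%N.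
Proof.
rewrite [RHS]big_mkcond /finite_prod.
apply: (proj2 (_ : _ != 0 /\ _)); apply: (big_rec2 (fun P n => P != 0 /\ mup b P = n)).
  by rewrite oner_neq0 mupNroot // root1.
move=> k P n _ [P0 <-].
have F0 : (if a k is Some b then ('X - b%:P) ^+ c k else 1) != 0 :> {poly C}.
  by case: (a k) => [b'|]; rewrite ?oner_neq0 // expf_neq0 // polyXsubC_eq0.
split; first by rewrite mulf_neq0.
rewrite mupM //; congr (_ + _)%N; case: (a k) => [b'|].
  by rewrite mup_XsubCX.
by rewrite mupNroot // root1.
Qed.

Lemma degree_finite_prod c :
  (size (finite_prod c)).-1 = (\sum_(k | a k != None) c k)%N.
Proof.
rewrite [RHS]big_mkcond /finite_prod.
apply: (proj2 (_ : _ != 0 /\ _)).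
apply: (big_rec2 (fun (P : {poly C}) (n : nat) => P != 0 /\ (size P).-1 = n)).
  by rewrite oner_neq0 size_poly1.
move=> k P n _ [P0 <-]; case: (a k) => [b|]; last by rewrite mul1r.
have F0 : ('X - b%:P) ^+ c k != 0 by rewrite expf_neq0 // polyXsubC_eq0.
split; first by rewrite mulf_neq0.
rewrite size_mul // size_exp_XsubC /=.
by rewrite -[in LHS](@prednK (size P)) ?addnS // lt0n size_poly_eq0.
Qed.

Lemma branch_index_at k : branch_index a (a k) = bd_d D k.
Proof.
rewrite /branch_index (big_pred1 k) // => k'.
by apply/eqP/eqP => [/a_inj|->].
Qed.

Variables (T i : nat).
Hypothesis d_sum : (\sum_k bd_d D k = T * m)%N.

Definition pole_order (k : 'I_(bd_n D).+3) : nat := ceil_div m (i * bd_d D k).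

Definition denominator : {poly C} := finite_prod pole_order.

(** One more than the largest degree allowed for the numerator by the condition at
    infinity, or [0] when no nonzero numerator is allowed. *)
Definition numerator_bound : nat := ((\sum_k pole_order k).-1 - i * T)%N.

Lemma sum_pole_order p :
  (\sum_(k | a k == p) pole_order k)%N = ceil_div m (i * branch_index a p).
Proof.
case: (pickP (fun k => a k == p)) => [k /eqP <-|nop].
  rewrite branch_index_at (big_pred1 k) // => k'.
  by apply/eqP/eqP => [/a_inj|->].
by rewrite /branch_index !big_pred0 // muln0 ceil_div0 // bd_m_gt0.
Qed.

Lemma holomorphic_local (h : {fraction {poly C}}) p : h != 0 ->
  let num := (frac (repr h)).1 in let den := (frac (repr h)).2 in
  num != 0 -> den != 0 ->
  holomorphic_over a (h *: 'X^i) p <->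
  if p is Some b then (mup b den <= mup b num + mup b denominator)%N
  else ((size num).-1 + 2 + i * T <=
        (size den).-1 + ceil_div m (i * branch_index a None))%N.
Proof.
move=> h0 num den num0 den0; rewrite holomorphic_overE // -/num -/den.
have m0 := bd_m_gt0 D; have e0 := ramification_gt0 a p.
pose g := gcdn m (branch_index a p).
have g0 : (0 < g)%N by rewrite gcdn_gt0 m0.
have mE : m = (g * ramification a p)%N by rewrite mulnC /ramification divnK // dvdn_gcdl.
have [D' DE] : exists D', branch_index a p = (g * D')%N.
  by have /dvdnP[D' ->] := dvdn_gcdr m (branch_index a p); exists D'; rewrite mulnC.
case: p e0 @g g0 mE DE => [b|] e0 g g0 mE DE.
  rewrite [mup b denominator]mup_finite_prod sum_pole_order ceil_divP // DE.
  rewrite /poly_order /dx_order [mup b (cover_poly a)]mup_finite_prod.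
  rewrite -/(branch_index a (Some b)) DE [bd_m D in X in X <-> _]mE [bd_m D in X in _ <-> X]mE.
  exact: finite_pole_bound.
rewrite ceil_divP // DE /poly_order /dx_order (degree_finite_prod (bd_d D)).
rewrite [bd_m D in X in X <-> _]mE [bd_m D in X in _ <-> X]mE.
apply: infinite_pole_bound => //; rewrite -mE -DE -d_sum.
by rewrite [RHS](bigID (fun k => a k == None)) /= addnC.
Qed.

Lemma degreeM (P Q : {poly C}) : P != 0 -> Q != 0 ->
  (size (P * Q)%R).-1 = ((size P).-1 + (size Q).-1)%N.
Proof.
move=> P0 Q0; rewrite size_mul //.
move: P0 Q0; rewrite -!size_poly_eq0.
by move: (size P) (size Q) => [|x] [|y] //= _ _; rewrite addnS.
Qed.

(** The conditions at finite points say that the poles of [h] are bounded by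
    [denominator], point by point, which over an algebraically closed field is a
    divisibility; the condition at infinity then bounds the degree of what is
    left. *)
Lemma holomorphic_formP (h : {fraction {poly C}}) : (i < m)%N ->
  holomorphic_form a (h *: 'X^i) <->
  exists2 P : {poly C}, h = FracField.tofrac P / FracField.tofrac denominator &
    (size P <= numerator_bound)%N.
Proof.
move=> i_lt; have W0 := finite_prod_neq0 pole_order; rewrite -/denominator in W0.
have W'0 : FracField.tofrac denominator != 0 by rewrite tofrac_eq0.
have [->|h0] := eqVneq h 0.
  split=> _; first by exists 0; rewrite ?rmorph0 ?mul0r // size_poly0.
  split; first by rewrite scale0r size_poly0.
  move=> p; exists 1, 0; split=> // t y _ _.
  by rewrite scale0r /eval_form size_poly0 big_ord0 mul0r normr0.
have := frac_repr_div h; have := frac_repr_neq0 h0; have := denom_ratioP (repr h).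
have := fun p => holomorphic_local p h0; cbv zeta.
move: (frac (repr h)).1 (frac (repr h)).2 => num den loc den0 num0 hE.
have {}loc p := loc p num0 den0.
have split_sum : (\sum_k pole_order k = (size denominator).-1 +
                    ceil_div m (i * branch_index a None))%N.
  rewrite (bigID (fun k => a k == None)) /= sum_pole_order addnC.
  by rewrite degree_finite_prod.
have PE_iff P : h = FracField.tofrac P / FracField.tofrac denominator <->
             num * denominator = P * den.
  rewrite {1}hE.
  exact: tofrac_div_eq.
split=> [[_ h_hol]|[P /PE_iff PE P_size]].
  have /dvdpP[P PE] : den %| num * denominator.
    apply: dvdp_mup => //; first by rewrite mulf_neq0.
    by move=> b; rewrite mupM //; have /loc := h_hol (Some b).
  have P0 : P != 0.
    by apply: contraTneq (mulf_neq0 num0 W0) => P0; rewrite PE P0 mul0r eqxx.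
  exists P; first by apply/PE_iff.
  have /loc := h_hol None.
  have := congr1 (fun P : {poly C} => (size P).-1) PE; rewrite !degreeM //.
  rewrite /numerator_bound split_sum; move: P0; rewrite -size_poly_eq0.
  move: (ceil_div _ _) (i * T)%N => u v.
  move: (size num).-1 (size den).-1 (size denominator).-1 (size P) => dn dd dW sP.
  by clear; lia.
have P0 : P != 0.
  by apply: contraTneq (mulf_neq0 num0 W0) => P0; rewrite PE P0 mul0r eqxx.
split.
  by rewrite size_scale // size_polyXn.
case=> [b|]; apply/loc.
  by rewrite -mupM // PE mupM // leq_addl.
have := congr1 (fun P : {poly C} => (size P).-1) PE; rewrite !degreeM //.
move: P_size; rewrite /numerator_bound split_sum; move: P0; rewrite -size_poly_eq0.
move: (ceil_div _ _) (i * T)%N => u v.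
move: (size num).-1 (size den).-1 (size denominator).-1 (size P) => dn dd dW sP.
by clear; lia.
Qed.

End Holomorphic.

(** * Dimensions of the eigenspaces *)
HB.instance Definition _ (R : realType) := GRing.RMorphism.copy (@const R)
  (@FracField.tofrac {poly R[i]} \o @polyC R[i]).

Section Dimension.
Variable R : realType.
Local Notation C := R[i].
Implicit Types V : Defs.form R -> Prop.

(** Expressing each family through the other gives matrices [A] and [B] with
    [A *m B = 1], by freeness of the first family. *)
Lemma has_dim_le V d d' : has_dim V d -> has_dim V d' -> (d <= d')%N.
Proof.
move=> [w [w_free w_span]] [w' [_ w'_span]].
have w_in i : V (w i).
  apply/w_span; exists (fun k => (k == i)%:R); rewrite (bigD1 i) //= eqxx.
  rewrite big1 ?addr0 => [|k /negPf ->]; first by rewrite rmorph1 scale1r.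
  by rewrite rmorph0 scale0r.
have w'_in i : V (w' i).
  apply/w'_span; exists (fun k => (k == i)%:R); rewrite (bigD1 i) //= eqxx.
  rewrite big1 ?addr0 => [|k /negPf ->]; first by rewrite rmorph1 scale1r.
  by rewrite rmorph0 scale0r.
have [A wE] : {A : 'I_d -> 'I_d' -> C & forall i, w i = \sum_k const (A i k) *: w' k}.
  exact: (choice (fun i => proj1 (w'_span _) (w_in i))).
have [B w'E] : {B : 'I_d' -> 'I_d -> C & forall i, w' i = \sum_k const (B i k) *: w k}.
  exact: (choice (fun i => proj1 (w_span _) (w'_in i))).
apply: (@mulmx1_min _ _ _ (\matrix_(i, k) A i k) (\matrix_(k, l) B k l)).
apply/matrixP => i l; rewrite !mxE; apply/eqP; rewrite -subr_eq0; apply/eqP.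
pose c l := \sum_k (\matrix_(i, k) A i k) i k * (\matrix_(k, l) B k l) k l - (i == l)%:R.
apply: (w_free c); rewrite {}/c.
have -> : \sum_l const (\sum_k (\matrix_(i, k) A i k) i k * (\matrix_(k, l) B k l) k l
   - (i == l)%:R) *: w l = \sum_l (\sum_k const (A i k) * const (B k l)) *: w l - w i.
  rewrite -[in RHS](_ : \sum_l const (i == l)%:R *: w l = w i); last first.
    rewrite (bigD1 i) //= eqxx big1 ?addr0 => [|k]; first by rewrite rmorph1 scale1r.
    by rewrite eq_sym => /negPf ->; rewrite rmorph0 scale0r.
  rewrite -sumrB; apply: eq_bigr => k _; rewrite -scalerBl; congr (_ *: _).
  rewrite rmorphB rmorph_sum /=; congr (_ - _).
  by apply: eq_bigr => l' _; rewrite !mxE rmorphM.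
apply/eqP; rewrite subr_eq0; apply/eqP; rewrite [RHS]wE.
under eq_bigr do rewrite scaler_suml.
rewrite exchange_big /=; apply: eq_bigr => k _; rewrite w'E scaler_sumr.
by apply: eq_bigr => l' _; rewrite scalerA.
Qed.

Lemma has_dim_uniq V d d' : has_dim V d -> has_dim V d' -> d = d'.
Proof. by move=> h h'; apply/eqP; rewrite eqn_leq !(@has_dim_le V). Qed.

Lemma has_dim_iff V V' d : (forall g, V g <-> V' g) -> has_dim V d -> has_dim V' d.
Proof.
move=> VV' [w [w_free w_span]]; exists w; split=> // g.
by rewrite -VV'; apply: w_span.
Qed.

Lemma has_dim_fractions (W : {poly C}) i d : W != 0 ->
  has_dim (fun g => exists2 P : {poly C},
     g = (FracField.tofrac P / FracField.tofrac W) *: 'X^i & (size P <= d)%N) d.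
Proof.
move=> W0; have W'0 : FracField.tofrac W != 0 by rewrite tofrac_eq0.
pose w (l : 'I_d) : Defs.form R := (FracField.tofrac 'X^l / FracField.tofrac W) *: 'X^i.
have sumE (c : 'I_d -> C) : \sum_l const (c l) *: w l =
    (FracField.tofrac (\sum_l c l *: 'X^l) / FracField.tofrac W) *: 'X^i.
  rewrite rmorph_sum mulr_suml scaler_suml; apply: eq_bigr => l _.
  by rewrite /w scalerA mulrA -[c l *: 'X^l]mul_polyC rmorphM.
exists w; split=> [c|g].
  rewrite sumE => /eqP; rewrite scaler_eq0 -size_poly_eq0 size_polyXn orbF.
  rewrite mulf_eq0 invr_eq0 (negPf W'0) orbF tofrac_eq0 => /eqP c0 l.
  have := congr1 (fun P : {poly C} => P`_l) c0; rewrite coef0 coef_sum (bigD1 l) //=.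
  rewrite coefZ coefXn eqxx mulr1 big1 ?addr0 // => k kl.
  by rewrite coefZ coefXn eq_sym val_eqE (negPf kl) mulr0.
split=> [[P -> P_size]|[c ->]].
  exists (fun l => P`_l); rewrite sumE; congr (_ / _ *: _); congr FracField.tofrac.
  rewrite -poly_def; apply/polyP => k; rewrite coef_poly; case: ltnP => // dk.
  by rewrite nth_default // (leq_trans P_size).
exists (\sum_l c l *: 'X^l); first by rewrite sumE.
apply: leq_trans (size_sum _ _ _) _; apply/bigmax_leqP => l _.
by rewrite (leq_trans (size_scale_leq _ _)) // size_polyXn.
Qed.

End Dimension.

Section Zeta.
Variables (R : realType) (D : branch_data).
Local Notation m := (bd_m D).
Local Notation zeta := (zeta R D).

Let theta : R := 2%:R * pi / m%:R.

Lemma zetaX k : zeta ^+ k = cos (k%:R * theta) +i* sin (k%:R * theta).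
Proof.
elim: k => [|k IHk]; first by rewrite mul0r cos0 sin0.
rewrite exprSr IHk /zeta -/theta -natr1 mulrDl mul1r cosD sinD.
by apply/eqP; rewrite eq_complex /=; apply/andP; split; apply/eqP; ring.
Qed.

Lemma zeta_m : zeta ^+ m = 1.
Proof.
rewrite zetaX /theta mulrC divfK ?pnatr_eq0 -?lt0n ?bd_m_gt0 // mulr_natl.
by rewrite cos2pi sin2pi.
Qed.

Lemma zeta_neq0 : zeta != 0.
Proof.
apply/eqP => z0; have := zeta_m; rewrite z0 expr0n gtn_eqF ?bd_m_gt0 //.
by move/eqP; rewrite eq_sym oner_eq0.
Qed.

(** If [zeta^r = 1] with [0 < r < m], the duplication formula for the cosine forces
    [sin (r pi / m) = 0], but the sine is positive on [(0, pi)]. *)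
Lemma zetaX_eq1 k : (zeta ^+ k == 1) = (m %| k)%N.
Proof.
have m0 := bd_m_gt0 D.
apply/eqP/idP => [|/dvdnP[q ->]]; last by rewrite mulnC exprM zeta_m expr1n.
rewrite {1}(divn_eq k m) exprD mulnC exprM zeta_m expr1n mul1r zetaX.
have [r0|r0] := posnP (k %% m); first by rewrite /dvdn r0.
have r_lt := ltn_pmod k m0; set r := (k %% m)%N in r0 r_lt *.
case=> cos1 _; exfalso; pose x : R := r%:R / m%:R * pi.
have xE : r%:R * theta = x *+ 2 by rewrite /theta /x -mulr_natl; ring.
have m0' : 0 < m%:R :> R by rewrite ltr0n.
have : 0 < sin x.
  apply: sin_gt0_pi; rewrite mulr_gt0 ?divr_gt0 ?ltr0n ?pi_gt0 //=.
  by rewrite gtr_pMl ?pi_gt0 // ltr_pdivrMr // mul1r ltr_nat.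
move: cos1; rewrite xE cos_mulr2n => cos1 sin0.
have := cos2Dsin2 x; have : 0 < sin x ^+ 2 by rewrite exprn_gt0.
by move: cos1; rewrite -mulr_natl; lra.
Qed.

Lemma conj_zetaX j : (j <= m)%N -> (zeta ^+ j)^* = zeta ^+ (m - j).
Proof.
move=> jm; apply: (mulIf (expf_neq0 j zeta_neq0)).
rewrite -exprD subnK // zeta_m zetaX.
apply/eqP; rewrite eq_complex /=; apply/andP; split; apply/eqP; last by ring.
rewrite -[RHS](cos2Dsin2 (j%:R * theta)); ring.
Qed.

Lemma psi_pushE (g : Defs.form R) k :
  (psi_push D g)`_k = const (zeta ^- k) * g`_k.
Proof.
rewrite /psi_push comp_polyE.
have -> : \sum_(l < size g) g`_l *: (const zeta^-1 *: 'X) ^+ l =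
          \poly_(l < size g) (const (zeta ^- l) * g`_l).
  rewrite poly_def; apply: eq_bigr => l _.
  by rewrite exprZn scalerA mulrC /const -exprVn !rmorphXn.
by rewrite coef_poly; case: ltnP => // gk; rewrite nth_default ?mulr0.
Qed.

End Zeta.

Section Hodge.
Variables (R : realType) (D : branch_data).
Local Notation m := (bd_m D).

Definition bd_seq : seq nat := [seq bd_d D k | k <- enum 'I_(bd_n D).+3].

Definition hodge (d : seq nat) (j : nat) : nat := (wsum m d j %/ m).-1.

Lemma size_bd_seq : size bd_seq = (bd_n D).+3.
Proof. by rewrite size_map size_enum_ord. Qed.

Lemma sumn_bd_seq (f : nat -> nat) :
  sumn [seq f x | x <- bd_seq] = (\sum_k f (bd_d D k))%N.
Proof. by rewrite sumnE /bd_seq -map_comp big_map big_enum. Qed.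

Lemma dvdn_sum_bd_d : (m %| \sum_k bd_d D k)%N.
Proof.
have m0 : m%:R != 0 :> rat by rewrite pnatr_eq0 -lt0n bd_m_gt0.
have : (\sum_k bd_d D k)%N%:R / m%:R \is a @Num.int rat.
  rewrite natr_sum mulr_suml; have := bd_mu_sum D.
  by congr (_ \is a _); apply: eq_bigr => k _; rewrite bd_dE mulrC mulKf.
move=> /intrP[z zE]; have z0 : (0 <= z)%R.
  by rewrite -(ler_int rat) -zE divr_ge0 ?ler0n.
apply/dvdnP; exists `|z|%N; apply/eqP; rewrite -(eqr_nat rat) natrM.
by rewrite [`|z|%N%:R]pmulrn gez0_abs // -zE divfK.
Qed.

(** Rounding [i x / m] up adds exactly the fractional part of [(m - i) x / m]. *)
Lemma ceil_divE i x : (i <= m)%N ->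
  (ceil_div m (i * x) * m = i * x + ((m - i) * x) %% m)%N.
Proof.
move=> i_le; have m0 := bd_m_gt0 D; have r_lt := ltn_pmod ((m - i) * x) m0.
have /dvdnP[q qE] : (m %| i * x + ((m - i) * x) %% m)%N.
  by rewrite /dvdn modnDmr -mulnDl subnKC // modnMr.
rewrite qE; congr (_ * _)%N; rewrite /ceil_div.
have -> : (i * x + m.-1 = q * m + (m.-1 - ((m - i) * x) %% m))%N by lia.
by rewrite divnMDl // divn_small ?addn0 //; lia.
Qed.

Variables (a : 'I_(bd_n D).+3 -> P1 R).
Hypothesis a_inj : injective a.

Lemma numerator_boundE T j : (\sum_k bd_d D k = T * m)%N -> (0 < j < m)%N ->
  numerator_bound D T (m - j) = hodge bd_seq j.
Proof.
move=> d_sum j_bnd; have m0 := bd_m_gt0 D; rewrite /numerator_bound /hodge /wsum.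
rewrite (sumn_bd_seq (fun x => j * x %% m)%N).
have : ((\sum_k @pole_order D (m - j) k) * m = (m - j) * T * m +
         \sum_k (j * bd_d D k) %% m)%N.
  rewrite -mulnA -d_sum. rewrite big_distrl big_distrr -big_split /=; apply: eq_bigr => k _.
  by rewrite /pole_order ceil_divE ?leq_subr // subKn //; lia.
move: (\sum_k pole_order _ _)%N ((m - j) * T)%N (\sum_k (_ %% _))%N => s t u e.
have -> : u = ((s - t) * m)%N by rewrite mulnBl e addKn.
by rewrite mulnK //; lia.
Qed.

(** Comparing coefficients of [y^k], an eigenform for [zeta^j] can only involve the
    exponent [k < m] with [j + k] divisible by [m]. *)
Lemma holomorphic_eigenformP T j g : (\sum_k bd_d D k = T * m)%N -> (0 < j < m)%N ->
  holomorphic_eigenform a (zeta R D ^+ j) g <->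
  exists2 P : {poly R[i]},
    g = (FracField.tofrac P / FracField.tofrac (denominator a (m - j))) *: 'X^(m - j) &
    (size P <= hodge bd_seq j)%N.
Proof.
move=> d_sum j_bnd; have mj_lt : (m - j < m)%N by lia.
rewrite -(numerator_boundE d_sum) //; split.
  case=> g_hol g_eig.
  have gE : g = g`_(m - j) *: 'X^(m - j).
    apply/polyP => k; rewrite coefZ coefXn.
    have [->|k_ne] := eqVneq k (m - j)%N; first by rewrite mulr1.
    have [mk|k_lt] := leqP m k.
      by rewrite nth_default ?mulr0 //; apply: leq_trans mk; case: g_hol.
    rewrite mulr0; have [//|gk0] := eqVneq g`_k 0; case/eqP: k_ne.
    have := congr1 (fun p : Defs.form R => p`_k) g_eig; rewrite psi_pushE coefZ.
    move/(mulIf gk0)/fmorph_inj => zk.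
    have : (m %| j + k)%N.
      by rewrite -(zetaX_eq1 R) exprD -zk mulVf // expf_neq0 // zeta_neq0.
    by case/dvdnP=> -[|[|q]]; rewrite ?mulSn; lia.
  move: g_hol; rewrite gE => /(holomorphic_formP a_inj d_sum _ mj_lt)[P PE P_size].
  by exists P => //; rewrite -PE.
case=> P -> P_size; split; first by apply/(holomorphic_formP a_inj d_sum _ mj_lt); exists P.
apply/polyP => k; rewrite psi_pushE !coefZ coefXn.
case: eqVneq => [->|_]; last by rewrite !mulr0.
congr (const _ * _); apply: (mulIf (expf_neq0 (m - j) (zeta_neq0 R D))).
by rewrite mulVf ?expf_neq0 ?zeta_neq0 // -exprD subnKC ?zeta_m //; lia.
Qed.

Lemma h10P j p : (0 < j < m)%N -> h10 a j p <-> p = hodge bd_seq j.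
Proof.
move=> j_bnd; have /dvdnP[T d_sum] := dvdn_sum_bd_d.
have V_dim : has_dim (holomorphic_eigenform a (zeta R D ^+ j)) (hodge bd_seq j).
  apply: has_dim_iff (has_dim_fractions _ _ (finite_prod_neq0 a (pole_order (m - j)))) => g.
  by apply: iff_sym; apply: holomorphic_eigenformP d_sum j_bnd.
by split=> [h|->//]; apply: has_dim_uniq h V_dim.
Qed.

Lemma h01P j q : (0 < j < m)%N -> h01 a j q <-> q = hodge bd_seq (m - j).
Proof.
by move=> j_bnd; rewrite /h01 conj_zetaX; [apply: h10P | ]; lia.
Qed.

End Hodge.

(** * Families up to equivalence *)
Lemma bd_d_bounds D k : (0 < bd_d D k < bd_m D)%N.
Proof.
have m0 : 0 < (bd_m D)%:R :> rat by rewrite ltr0n bd_m_gt0.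
have /andP[mu0 mu1] := bd_mu_bounds k.
by rewrite -(ltr_nat rat) -[X in _ && X](ltr_nat rat) bd_dE mulr_gt0 //= gtr_pMr.
Qed.

Lemma bd_seq_bounds D : all (fun x => 0 < x < bd_m D)%N (bd_seq D).
Proof. by apply/allP => _ /mapP[k _ ->]; apply: bd_d_bounds. Qed.

Lemma dvdn_sumn_bd_seq D : (bd_m D %| sumn (bd_seq D))%N.
Proof. by have := sumn_bd_seq D id; rewrite map_id => ->; apply: dvdn_sum_bd_d. Qed.

(** A common divisor [c] of [m] and all [d_k] would make [m / c] clear all
    denominators. *)
Lemma gcdn_bd_seq D : foldr gcdn (bd_m D) (bd_seq D) = 1%N.
Proof.
set c := foldr _ _ _; have : (c %| c)%N by [].
rewrite {2}/c dvdn_foldr_gcdn => /andP[/dvdnP[q qE] /allP c_d].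
have m0 := bd_m_gt0 D; have [q0 c0] : (0 < q)%N /\ (0 < c)%N.
  by move: m0; rewrite qE muln_gt0 => /andP[].
have : clears_denominators D q.
  rewrite /clears_denominators q0; apply/forallP => k.
  have /dvdnP[z zE] := c_d _ (map_f (bd_d D) (mem_enum 'I_(bd_n D).+3 k)).
  have c0' : c%:R != 0 :> rat by rewrite pnatr_eq0 -lt0n.
  have -> : q%:R * bd_mu D k = z%:R by apply: (mulIf c0'); rewrite -natrM -zE bd_dE qE natrM mulrAC.
  exact: natr_int.
move: qE; rewrite /bd_m; case: ex_minnP => m _ m_min mE /m_min.
by rewrite mE -[X in (_ <= X)%N -> _]muln1 leq_pmul2l //; lia.
Qed.

Section Pure.
Variables (R : realType) (D : branch_data).
Local Notation m := (bd_m D).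
Local Notation d := (bd_seq D).

Lemma eigenspace_typeP j p q : (0 < j < m)%N ->
  eigenspace_type R D j p q <-> p = hodge D d j /\ q = hodge D d (m - j).
Proof.
move=> j_bnd; split=> [|[-> ->] a a_inj].
  have a_inj : injective (fun k : 'I_(bd_n D).+3 => Some (k : nat)%:R : P1 R).
    by move=> k k' [/eqP]; rewrite eqr_nat => /eqP/val_inj.
  by move/(_ _ a_inj)=> [/(h10P a_inj _ j_bnd) -> /(h01P a_inj _ j_bnd) ->].
by split; [apply/(h10P a_inj _ j_bnd) | apply/(h01P a_inj _ j_bnd)].
Qed.

Lemma hodge_eq0 j : (hodge D d j == 0%N) = (wsum m d j < 2 * m)%N.
Proof. by rewrite /hodge -ltn_divLR ?bd_m_gt0 //; case: (_ %/ _)%N => [|[|]]. Qed.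

Lemma hodge_eqS j k : (hodge D d j == k.+1) = (wsum m d j == k.+2 * m)%N.
Proof.
have m0 := bd_m_gt0 D; rewrite /hodge.
have /dvdnP[w ->] := dvdn_wsum j (dvdn_sumn_bd_seq D).
by rewrite mulnK // eqn_pmul2r //; case: w.
Qed.

(** If [j] has type [(1, n)], its two residue sums [2m] and [(n + 1) m] add up to [m]
    times the number of points, so no [j d_k] is divisible by [m]. *)
Lemma pure_VHSP : pure_VHS R D <-> exists j, pure_at m j d.
Proof.
have m0 := bd_m_gt0 D; have n0 := bd_n_gt0 D; have sz := size_bd_seq D.
split=> [[j [j_bnd /(eigenspace_typeP _ _ j_bnd)[h1 hn] _ other]]|[j j_pure]]; exists j.
  have w1 : wsum m d j = (2 * m)%N by apply/eqP; rewrite -hodge_eqS -h1.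
  have wn : wsum m d (m - j) = ((bd_n D).+1 * m)%N.
    by move: n0 hn; case: (bd_n D) => // n _ hn; apply/eqP; rewrite -hodge_eqS -hn.
  have /eqP : (m * (bd_n D).+3 = m * count (fun x => ~~ (m %| j * x)) d)%N.
    by rewrite -wsum_opp ?w1 ?wn //; lia.
  rewrite eqn_pmul2l // -sz eq_sym -all_count => /allP d_ne.
  split=> //; last 2 first.
  - exact: dvdn_sumn_bd_seq.
  - move=> i i_bnd /eqP ij /eqP imj; rewrite /mixed negb_and -!ltnNge -!hodge_eq0.
    case: (other i i_bnd ij imj) => -[e /(eigenspace_typeP _ _ i_bnd)[h h']].
      by rewrite -h' orbT.
    by rewrite -h.
  by apply/allP => x x_d; rewrite d_ne // andbT; have /andP[] := allP (bd_seq_bounds D) x x_d.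
case: j_pure => j_bnd d_ne _ d_j d_i.
have h1 : hodge D d j = 1%N by apply/eqP; rewrite hodge_eqS d_j.
have hn : hodge D d (m - j) = bd_n D.
  have d_count : count (fun x => ~~ (m %| j * x))%N d = (bd_n D).+3.
    by rewrite -sz; apply/eqP; rewrite -all_count; apply: sub_all d_ne => x /andP[].
  have := wsum_opp d m0 (_ : j <= m)%N; rewrite d_j d_count => /(_ ltac:(lia)) e.
  rewrite /hodge; have -> : wsum m d (m - j) = ((bd_n D).+1 * m)%N by lia.
  by rewrite mulnK.
split=> //.
- by apply/eigenspace_typeP.
- apply/eigenspace_typeP; first by lia.
  by rewrite subKn ?h1 ?hn //; lia.
move=> i i_bnd /eqP ij /eqP imj; have := d_i i i_bnd ij imj.
rewrite /mixed negb_and -!ltnNge -!hodge_eq0 => /orP[/eqP h|/eqP h]; [right|left].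
  by exists (hodge D d (m - i)); apply/eigenspace_typeP; rewrite ?h.
by exists (hodge D d i); apply/eigenspace_typeP; rewrite ?h.
Qed.

End Pure.

Lemma equiv_dataP m d d' : (0 < m)%N ->
  reflect (exists2 u, coprime u m & perm_eq d' [seq (u * x) %% m | x <- d]%N)
          (equiv_data m d d').
Proof.
move=> m0; apply: (iffP hasP) => [[u _ /andP[um h]]|[u um h]]; first by exists u.
exact/hasP/(equiv_dataI m0 um h).
Qed.

(** The inverse of [u] modulo [m] is [u^(totient m - 1)]. *)
Lemma equiv_data_sym m d d' : (0 < m)%N -> all (fun x => x < m)%N d ->
  equiv_data m d d' -> equiv_data m d' d.
Proof.
move=> m0 d_bnd /(equiv_dataP _ _ m0)[u um h]; apply/(equiv_dataP _ _ m0).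
exists (u ^ (totient m).-1)%N; first exact: coprimeXl.
rewrite perm_sym; apply: perm_trans (perm_map _ h) _; rewrite -map_comp.
apply: (eq_ind _ (fun e => perm_eq e d) (perm_refl d)).
rewrite -[LHS]map_id; apply/eq_in_map => x x_d /=.
rewrite modnMmr mulnA -expnSr prednK ?totient_gt0 // -modnMml cyclic.Euler_exp_totient //.
by rewrite modnMml mul1n modn_small // (allP d_bnd).
Qed.

Lemma equiv_data_trans m d d' d'' : (0 < m)%N ->
  equiv_data m d d' -> equiv_data m d' d'' -> equiv_data m d d''.
Proof.
move=> m0 /(equiv_dataP _ _ m0)[u um h] /(equiv_dataP _ _ m0)[v vm h'].
apply/(equiv_dataP _ _ m0); exists (v * u)%N; first by rewrite coprimeMl vm.
apply: perm_trans h' _; apply: perm_trans (perm_map _ h) _; rewrite -map_comp.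
apply: (eq_ind _ (perm_eq _) (perm_refl _)).
by apply: eq_map => x /=; rewrite modnMmr mulnA.
Qed.

(** A permutation of the multiset of branch indices gives back a bijection of the
    index types: [k] is sent to the position that the reordered list [e] of
    indices assigns to it. *)
Lemma same_familyP D D' : same_family D D' <->
  bd_m D = bd_m D' /\ equiv_data (bd_m D) (bd_seq D) (bd_seq D').
Proof.
have m0 := bd_m_gt0 D; split=> [[mm nn [s [u [s_bij um sE]]]]|[mm]].
  split=> //; apply/(equiv_dataP _ _ m0); exists u => //.
  have s_enum : perm_eq (enum 'I_(bd_n D').+3) (map s (enum 'I_(bd_n D).+3)).
    apply: uniq_perm; first exact: enum_uniq.
      by rewrite map_inj_uniq ?enum_uniq //; apply: bij_inj.
    move=> k; rewrite mem_enum; case: s_bij => s' _ s'K.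
    by apply/esym/mapP; exists (s' k); rewrite ?mem_enum ?s'K.
  apply: perm_trans (perm_map _ s_enum) _; rewrite /bd_seq -!map_comp.
  apply: (eq_ind _ (perm_eq _) (perm_refl _)); apply: eq_map => k /=.
  by rewrite -sE mm modn_small //; have /andP[] := bd_d_bounds (s k).
move/(equiv_dataP _ _ m0) => [u um]; rewrite perm_sym.
rewrite {1}/bd_seq -map_comp => /perm_map_lift[e e_perm eE].
have e_size : size e = size (enum 'I_(bd_n D').+3).
  by have := congr1 size eE; rewrite !size_map.
have nn : bd_n D = bd_n D'.
  by apply/eqP; move: e_size; rewrite -(perm_size e_perm) !size_enum_ord => -[->].
split=> //.
have e_lt k : (index k e < size (enum 'I_(bd_n D').+3))%N.
  by rewrite -e_size index_mem -(perm_mem e_perm) mem_enum.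
pose s (k : 'I_(bd_n D).+3) := nth (inord 0) (enum 'I_(bd_n D').+3) (index k e).
exists s, u; split=> //.
  apply: inj_card_bij; last by rewrite !card_ord nn.
  move=> k l /eqP; rewrite nth_uniq ?enum_uniq // => /eqP kl.
  have e_in i : i \in e by rewrite -(perm_mem e_perm) mem_enum.
  by rewrite -(nth_index k (e_in k)) kl nth_index.
move=> k; have := congr1 (fun l => nth 0%N l (index k e)) eE.
rewrite (nth_map k) ?e_size // nth_index -?(perm_mem e_perm) ?mem_enum //=.
by rewrite (nth_map (inord 0)) // -/(s k) => <-; rewrite modn_mod.
Qed.

Lemma same_family_refl D : same_family D D.
Proof.
apply/same_familyP; split=> //; have m0 := bd_m_gt0 D.
apply/(equiv_dataP _ _ m0); exists 1%N; first exact: coprime1n.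
apply: (eq_ind _ (perm_eq _) (perm_refl _)); rewrite -[LHS]map_id.
apply/eq_in_map => x x_d; rewrite mul1n modn_small //.
by have /andP[] := allP (bd_seq_bounds D) x x_d.
Qed.

Lemma same_family_sym D D' : same_family D D' -> same_family D' D.
Proof.
move=> /same_familyP[mm dd']; apply/same_familyP; split=> //; rewrite -mm.
apply: equiv_data_sym dd'; first exact: bd_m_gt0.
by apply: sub_all (bd_seq_bounds D) => x /andP[].
Qed.

Lemma same_family_trans D D' D'' :
  same_family D D' -> same_family D' D'' -> same_family D D''.
Proof.
move=> /same_familyP[mm dd'] /same_familyP[mm' d'd'']; apply/same_familyP.
by split; [rewrite mm | apply: equiv_data_trans dd' _; rewrite ?bd_m_gt0 // mm].
Qed.

Lemma same_family_classE D D' :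
  ([set E | same_family D E] = [set E | same_family D' E])%classic <-> same_family D D'.
Proof.
split=> [e|DD'].
  have : ([set E | same_family D' E] D)%classic by rewrite -e; apply: same_family_refl.
  exact: same_family_sym.
apply/seteqP; split=> E /=; last exact: same_family_trans.
by apply: same_family_trans; apply: same_family_sym.
Qed.

Lemma dvdn_mul_foldr_gcdn m q d : (m %| q * m)%N ->
  all (fun x => m %| q * x)%N d -> (m %| q * foldr gcdn m d)%N.
Proof.
move=> qm; elim: d => //= x d IHd /andP[qx /IHd qd].
by rewrite muln_gcdr dvdn_gcd qx.
Qed.

(** Data with overall gcd [1] are realized by [mu_k = d_k / m]: if [q] clears the
    denominators then [m] divides all [q d_k], hence [q]. *)
Lemma branch_data_of_seq m d : (4 <= size d)%N -> all (fun x => 0 < x < m)%N d ->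
  (m %| sumn d)%N -> foldr gcdn m d = 1%N ->
  exists D, bd_m D = m /\ bd_seq D = d.
Proof.
move=> d_ge4 d_bnd d_sum d_gcd; pose n := (size d - 3)%N.
have n0 : (0 < n)%N by rewrite subn_gt0.
have dn : size d = n.+3 by rewrite /n; lia.
have m0 : (0 < m)%N.
  by case: d d_ge4 d_bnd {d_sum d_gcd n n0 dn} => //= x d _ /andP[]; lia.
have m0' : m%:R != 0 :> rat by rewrite pnatr_eq0 -lt0n.
pose mu (k : 'I_n.+3) : rat := (nth 0%N d k)%:R / m%:R.
have nth_bnd (k : 'I_n.+3) : (0 < nth 0%N d k < m)%N.
  by apply: (allP d_bnd); rewrite mem_nth // dn.
have mu_bounds k : 0 < mu k < 1.
  have /andP[d0 dm] := nth_bnd k.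
  by rewrite divr_gt0 ?ltr0n //= ltr_pdivrMr ?ltr0n // mul1r ltr_nat.
have mu_sum : \sum_k mu k \is a Num.int.
  rewrite -mulr_suml -natr_sum.
  have -> : (\sum_(k < n.+3) nth 0 d k)%N = sumn d.
    by rewrite sumnE (big_nth 0%N) dn big_mkord.
  by case/dvdnP: d_sum => q ->; rewrite natrM mulfK // natr_int.
pose D := BranchData n0 mu_bounds mu_sum.
have mE : bd_m D = m.
  rewrite /bd_m; case: ex_minnP => q /andP[q0 /forallP q_clear] q_min.
  apply/eqP; rewrite eqn_leq q_min /=; last first.
    by rewrite /clears_denominators m0; apply/forallP => k; rewrite mulrC divfK ?natr_int.
  apply: dvdn_leq => //; rewrite -[q]muln1 -d_gcd.
  apply: dvdn_mul_foldr_gcdn; first exact: dvdn_mull.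
  apply/(all_nthP 0%N) => k k_lt; have k_lt' : (k < n.+3)%N by rewrite -dn.
  have := q_clear (Ordinal k_lt'); rewrite /= /mu /= mulrA -natrM => /intrP[z zE].
  have z0 : 0 <= z by rewrite -(ler_int rat) -zE divr_ge0 ?ler0n.
  apply/dvdnP; exists `|z|%N; apply/eqP; rewrite -(eqr_nat rat) [in X in _ == X]natrM.
  by rewrite [`|z|%N%:R]pmulrn gez0_abs // -zE divfK.
exists D; split=> //; apply: (@eq_from_nth _ 0%N); rewrite size_bd_seq ?dn // => k k_lt.
have -> : nth 0%N (bd_seq D) k = bd_d D (Ordinal k_lt).
  rewrite /bd_seq (nth_map (Ordinal k_lt)) ?size_enum_ord //; congr bd_d.
  by apply: val_inj; rewrite /= nth_enum_ord.
apply/eqP; rewrite -(eqr_nat rat) bd_dE mE /= mulrC /mu divfK //.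
Qed.

Local Open Scope classical_set_scope.
Local Open Scope card_scope.

Theorem theorem3 (R : realType) :
  [set [set D' | same_family D D'] | D in [set D | pure_VHS R D]] #= `I_19.
Proof.
pose r i := nth (0%N, [::]) table i.
have r_in i : (i < 19)%N -> r i \in table by move=> i_lt; apply: mem_nth.
have [F F_data] : {F : nat -> branch_data & forall i, (i < 19)%N ->
    bd_m (F i) = (r i).1 /\ bd_seq (F i) = (r i).2}.
  have data i : (i < 19)%N -> exists D, bd_m D = (r i).1 /\ bd_seq D = (r i).2.
    move=> i_lt; have /and4P[h1 h2 /eqP h3 h4] := allP table_data _ (r_in i i_lt).
    apply: branch_data_of_seq => //.
    by have [j /pure_at_bounds] := is_pureP h2 h4.
  apply: (choice (P := fun i D => (i < 19)%N -> bd_m D = (r i).1 /\ bd_seq D = (r i).2)).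
  (* Indices beyond the table get an arbitrary value. *)
  move=> i; case: (ltnP i 19) => [/data[D ?]|_]; first by exists D.
  by have [D _] := data 0%N isT; exists D.
have F_pure i : (i < 19)%N -> pure_VHS R (F i).
  move=> i_lt; have [mE dE] := F_data i i_lt; apply/pure_VHSP; rewrite mE dE.
  by have /and4P[_ h2 _ h4] := allP table_data _ (r_in i i_lt); apply: is_pureP.
pose cls i := [set D' | same_family (F i) D'].
have -> : [set [set D' | same_family D D'] | D in [set D | pure_VHS R D]] = cls @` `I_19.
  apply/seteqP; split=> [_ [D /= /pure_VHSP[j j_pure] <-]|_ [i /= i_lt <-]]; last first.
    by exists (F i) => //; apply: F_pure.
  have d_ge4 : (4 <= size (bd_seq D))%N by rewrite size_bd_seq !ltnS bd_n_gt0.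
  have /hasP[q /(nthP (0%N, [::]))[i i_lt <-] /andP[/eqP mE dE]] :=
    pure_data_tabulated d_ge4 j_pure (gcdn_bd_seq D).
  have [FmE FdE] := F_data i i_lt.
  exists i => //; apply/same_family_classE/same_family_sym/same_familyP.
  by rewrite FmE FdE.
apply: inj_card_eq => i k; rewrite !inE => i_lt k_lt /same_family_classE/same_familyP.
have [-> ->] := F_data i i_lt; have [-> ->] := F_data k k_lt => -[m_ik d_ik].
have i_in : i \in iota 0 19 by rewrite mem_iota.
have k_in : k \in iota 0 19 by rewrite mem_iota.
have := allP (allP table_inequivalent i i_in) k k_in.
case/orP=> [/eqP //|/negP[]]; apply/andP; split; [exact/eqP | exact: d_ik].
Qed.
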